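(* There is an algorithm which, given a finite set $B$ of permutations, decides whether the permutation class $\mathrm{Av}(B)$ contains infinitely many simple permutations.
   Context: A permutation $\pi$ contains $\sigma$ if some subsequence of $\pi$ has the same relative order as $\sigma$. $\mathrm{Av}(B)$ is the set of permutations containing no element of $B$. An interval of a permutation is a set of contiguous positions whose values form a contiguous set; a permutation of length $n$ is simple if its only intervals have sizes $0,1,n$. *)

(* Defs.v *)
From mathcomp Require Import all_boot.
Set Implicit Arguments. Unset Strict Implicit. Unset Printing Implicit Defensive.

Definition is_perm (s : seq nat) : Prop := perm_eq s (iota 1 (size s)).

Definition order_iso (s t : seq nat) : Prop :=
  size s = size t /\
  forall i j, i < size s -> j < size s ->
    (nth 0 s i < nth 0 s j) = (nth 0 t i < nth 0 t j).

Definition contains (pi sigma : seq nat) : Prop :=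
  exists m : bitseq, size m = size pi /\ order_iso (mask m pi) sigma.

Definition inAv (B : seq (seq nat)) (pi : seq nat) : Prop :=
  is_perm pi /\ forall beta, beta \in B -> ~ contains pi beta.

Definition is_interval (pi : seq nat) (i k : nat) : Prop :=
  exists a, perm_eq (take k (drop i pi)) (iota a k).

Definition simple_perm (pi : seq nat) : Prop :=
  is_perm pi /\
  forall i k, i + k <= size pi -> is_interval pi i k ->
    k = 0 \/ k = 1 \/ k = size pi.

Definition inf_many_simples (B : seq (seq nat)) : Prop :=
  ~ exists L : seq (seq nat),
      forall pi, simple_perm pi -> inAv B pi -> pi \in L.

Inductive recf : Type :=
| RZero : recf
| RSucc : recf
| RProj : nat -> recf
| RComp : recf -> seq recf -> recf
| RPrim : recf -> recf -> recf
| RMu   : recf -> recf.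

Inductive reval : recf -> seq nat -> nat -> Prop :=
| ev_zero v : reval RZero v 0
| ev_succ x v : reval RSucc (x :: v) x.+1
| ev_proj i v : i < size v -> reval (RProj i) v (nth 0 v i)
| ev_comp f gs v ys y :
    revals gs v ys -> reval f ys y -> reval (RComp f gs) v y
| ev_prim0 f g v y : reval f v y -> reval (RPrim f g) (0 :: v) y
| ev_primS f g n v r y :
    reval (RPrim f g) (n :: v) r -> reval g (n :: r :: v) y ->
    reval (RPrim f g) (n.+1 :: v) y
| ev_mu f v n :
    reval f (n :: v) 0 ->
    (forall m, m < n -> exists k, reval f (m :: v) k.+1) ->
    reval (RMu f) v n
with revals : seq recf -> seq nat -> seq nat -> Prop :=
| evs_nil v : revals [::] v [::]
| evs_cons g gs v y ys :
    reval g v y -> revals gs v ys -> revals (g :: gs) v (y :: ys).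

(** Standard injective computable coding of finite lists of permutations *)
Definition code_perms (B : seq (seq nat)) : nat :=
  CodeSeq.code (map CodeSeq.code B).

(* Main.v *)
Require Import Defs.
From mathcomp Require Import all_boot zify.
From Stdlib Require Import Classical.
Set Implicit Arguments. Unset Strict Implicit. Unset Printing Implicit Defensive.

(** A permutation is a finite set with two strict total orders, and an interval
is a set of points that no outside point separates in either order. If a simple
permutation is large in terms of [m], then one of two things happens.
- It contains a long pin sequence (a chain in which every point separates its
  predecessor from all earlier points). A chain is described by a word over a
  finite alphabet, and the patterns of length at most [m] that occur in it are
  recognised by a finite automaton. Pumping the word therefore produces
  arbitrarily long chains with no new patterns of length at most [m], and a
  chain is simple up to a bounded number of points at its ends.
- All chains are short. The Erdos-Szekeres theorem gives a long monotone
  sequence. As chains starting inside it are short and must reach every point,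
  some of them jump far away from it, and many such jumps form an alternation.
  After a second use of Erdos-Szekeres the alternation is parallel, hence
  simple, or a wedge; a short chain leaving the tip of the wedge supplies the
  point(s) that make a long piece of the wedge simple. All these configurations
  exist in every size, with the same patterns of length at most [m].
Hence there is a computable bound [N] such that Av(B) contains infinitely many
simple permutations iff it contains one of length at least [N], in which case it
contains one of length between [N] and [N + 10]: this is a finite search. *)

(** * Closure properties of recursive functions *)

(** The obstacle is to keep the new simple permutations inside Av(B). It is met by asking that every
    set of at most [m] points of the new permutation embeds into the given one, where [m] bounds the
    lengths of the elements of B. The embedding may change with the set, so boundedly many points of
    the given permutation can serve arbitrarily large ones. The structural argument is classical and
    is never executed. The algorithm uses only its numerical bound and tests permutations one by
    one, so only this bound and elementary tests on codes have to be shown recursive. Two abstract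
    orders instead of a list of values make exchange and reversal of the orders available, so each
    configuration is treated in one orientation. The slack of 10 is shaped by pumping: a piece cut
    out of a pumped chain need not be simple, but shifting its two ends by a few places makes it
    so. *)

Definition computable (n : nat) (F : seq nat -> nat) : Prop :=
  exists p, forall v, size v = n -> reval p v (F v).

Lemma computable_ext n F G :
  (forall v, size v = n -> F v = G v) -> computable n F -> computable n G.
Proof. by move=> e [p Hp]; exists p => v sv; rewrite -e //; exact: Hp. Qed.

Lemma computable_nth n i : i < n -> computable n (fun v => nth 0 v i).
Proof. by move=> lin; exists (RProj i) => v sv; apply: ev_proj; rewrite sv. Qed.

Lemma computable_nth0 n : computable n.+1 (fun v => nth 0 v 0).
Proof. exact: computable_nth. Qed.

Lemma computable_nth1 n : computable n.+2 (fun v => nth 0 v 1).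
Proof. exact: computable_nth. Qed.

(** [List.In] is used because functions have no boolean equality. *)
Lemma computable_comp n Gs F :
  (forall G, List.In G Gs -> computable n G) -> computable (size Gs) F ->
  computable n (fun v => F [seq G v | G <- Gs]).
Proof.
move=> HG [f Hf].
have [gs Hgs]: exists gs, forall v, size v = n -> revals gs v [seq G v | G <- Gs].
  elim: Gs HG {F f Hf} => [|G Gs IH] HG; first by exists [::] => v _; constructor.
  have [gs Hgs] := IH (fun G' inG' => HG G' (or_intror inG')).
  have [g Hg] := HG G (or_introl erefl).
  by exists (g :: gs) => v sv /=; constructor; [apply: Hg | apply: Hgs].
exists (RComp f gs) => v sv; apply: ev_comp (Hgs v sv) _.
by apply: Hf; rewrite size_map.
Qed.

Definition computable1 (f : nat -> nat) := computable 1 (fun v => f (nth 0 v 0)).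
Lemma computable_app1 n f F :
  computable1 f -> computable n F -> computable n (fun v => f (F v)).
Proof.
move=> cf cF; apply: (computable_comp (Gs := [:: F])) cf.
by move=> G [<-|[]].
Qed.

Lemma InP (T : eqType) (x : T) s : reflect (List.In x s) (x \in s).
Proof.
elim: s => [|y s IH] /=; first by right.
rewrite inE; apply: (iffP orP) => -[].
- by move/eqP->; left.
- by move/IH; right.
- by move->; left.
- by move/IH; right.
Qed.

Lemma computable_nths n (s : seq nat) F :
  all (fun i => i < n) s -> computable (size s) F ->
  computable n (fun v => F [seq nth 0 v i | i <- s]).
Proof.
move=> /allP ls cF; pose Gs := [seq (fun v : seq nat => nth 0 v i) | i <- s].
rewrite -[size s](size_map (fun i v => nth 0 v i)) in cF.
apply: computable_ext (computable_comp _ cF) => [v _|G].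
  by rewrite -map_comp.
by case/(List.in_map_iff _ _ _).1 => i [<- /InP /ls]; exact: computable_nth.
Qed.

Lemma computable_behead n F :
  computable n F -> computable n.+1 (fun v => F (behead v)).
Proof.
move=> cF; rewrite -[n](size_iota 1) in cF.
apply: computable_ext (computable_nths (n := n.+1) _ cF) => [v sv|]; last first.
  by apply/allP => i; rewrite mem_iota; lia.
congr (F _); case: v sv => // x v [<-] /=.
by rewrite (iotaDl 1 0) -map_comp -[RHS](mkseq_nth 0) /mkseq; apply: eq_map.
Qed.

Lemma computable_const n c : computable n (fun _ => c).
Proof.
elim: c => [|c IH]; first by exists RZero => v _; constructor.
by apply: (computable_app1 (f := S)) IH; exists RSucc => -[|x []] // _; constructor.
Qed.

(** The arguments of [g] follow [RPrim]: counter, previous value, parameters. The depth [F v]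
    depends on the parameters, so the argument list [F v :: v] is assembled from [F] and the
    projections. *)
Lemma computable_rec n (f : seq nat -> nat) (g : nat -> nat -> seq nat -> nat) F :
  computable n f ->
  computable n.+2 (fun v => g (nth 0 v 0) (nth 0 v 1) (behead (behead v))) ->
  computable n F ->
  computable n (fun v =>
    (fix rec k := if k is k'.+1 then g k' (rec k') v else f v) (F v)).
Proof.
move=> [p Hp] [q Hq] cF.
set R := (fun k v => (fix rec k := if k is k'.+1 then g k' (rec k') v else f v) k).
have cR : computable n.+1 (fun v => R (nth 0 v 0) (behead v)).
  exists (RPrim p q) => -[//|k v] [sv] /=.
  elim: k => [|k IH] /=; first by apply: ev_prim0; exact: Hp.
  apply: ev_primS IH _.
  by have := Hq (k :: R k v :: v); apply; rewrite /= sv.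
have {}cR : computable (size (F :: [seq (fun v => nth 0 v i) | i <- iota 0 n]))
   (fun v => R (nth 0 v 0) (behead v)) by rewrite /= size_map size_iota.
apply: computable_ext (computable_comp _ cR) => [v sv|G] /=.
  congr (R _ _); rewrite -map_comp -sv -[RHS](mkseq_nth 0) /mkseq; exact: eq_map.
case=> [<- //|].
case/(List.in_map_iff _ _ _).1 => i [<- /InP]; rewrite mem_iota => ?; exact: computable_nth.
Qed.

Lemma computable_iter n g F G :
  computable1 g -> computable n F -> computable n G ->
  computable n (fun v => iter (F v) g (G v)).
Proof.
move=> cg cF cG.
have := computable_rec (g := fun _ r _ => g r) cG _ cF.
move/(_ (computable_app1 cg (computable_nth1 n))).
by apply: computable_ext => v _; elim: (F v) => //= k ->.
Qed.

Lemma computable1_id : computable1 id.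
Proof. exact: computable_nth. Qed.

Lemma computable_succ n F : computable n F -> computable n (fun v => (F v).+1).
Proof.
by apply: computable_app1; exists RSucc => -[|x []] // _; constructor.
Qed.

Lemma computable_add n F G : computable n F -> computable n G ->
  computable n (fun v => F v + G v).
Proof.
move=> cF cG.
have cS : computable1 S by exact: computable_succ computable1_id.
apply: computable_ext (computable_iter cS cF cG) => v _.
by elim: (F v) => //= k ->.
Qed.

Lemma computable_mul n F G : computable n F -> computable n G ->
  computable n (fun v => F v * G v).
Proof.
move=> cF cG.
have c0 := computable_const n 0.
have := computable_rec (g := fun _ r v => G v + r) c0 _ cF.
move/(_ (computable_add (computable_behead (computable_behead cG))
   (computable_nth1 n))).
by apply: computable_ext => v _; elim: (F v) => //= k ->; rewrite mulSn.
Qed.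

Lemma computable_exp n F G : computable n F -> computable n G ->
  computable n (fun v => F v ^ G v).
Proof.
move=> cF cG.
have c0 := computable_const n 1.
have := computable_rec (g := fun _ r v => F v * r) c0 _ cG.
move/(_ (computable_mul (computable_behead (computable_behead cF))
   (computable_nth1 n))).
by apply: computable_ext => v _; elim: (G v) => //= k ->; rewrite expnS.
Qed.

Lemma computable_pred n F : computable n F -> computable n (fun v => (F v).-1).
Proof.
move=> cF.
have := computable_rec (g := fun k _ _ => k) (computable_const n 0) _ cF.
move/(_ (computable_nth0 n.+1)).
by apply: computable_ext => v _; case: (F v).
Qed.

Lemma computable_sub n F G : computable n F -> computable n G ->
  computable n (fun v => F v - G v).
Proof.
move=> cF cG.
have cS : computable1 predn by exact: computable_pred computable1_id.
apply: computable_ext (computable_iter cS cG cF) => v _.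
by elim: (G v) => /= [|k ->]; lia.
Qed.

Lemma computable_sum n F (G : nat -> seq nat -> nat) :
  computable n F ->
  computable n.+1 (fun v => G (nth 0 v 0) (behead v)) ->
  computable n (fun v => \sum_(i < F v) G i v).
Proof.
move=> cF cG.
have := computable_rec (g := fun k r v => r + G k v) (computable_const n 0) _ cF.
(* The step function also receives the accumulator, at index 1; the projections [0 :: iota 2 n] skip
   it. *)
have cG' : computable n.+2 (fun v => G (nth 0 v 0) (behead (behead v))).
  have := computable_nths (n := n.+2) (s := 0 :: iota 2 n) (F := fun v => G (nth 0 v 0) (behead v)).
  rewrite /= size_iota => /(_ _ cG) H.
  apply: computable_ext (H _) => [[|x [|y v]] //= [<-]|].
    congr (G x _).
    by rewrite (iotaDl 2 0) -map_comp -[RHS](mkseq_nth 0) /mkseq; apply: eq_map.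
  by apply/allP => i; rewrite mem_iota; lia.
move/(_ (computable_add (computable_nth1 n) cG')).
by apply: computable_ext => v _; elim: (F v) => [|k ->]; rewrite ?big_ord0 // big_ord_recr.
Qed.

(** * Decidable predicates and bounded quantifiers *)

Definition decidable_on n (P : seq nat -> bool) := computable n (fun v => P v).

Lemma decidable_not n P : decidable_on n P -> decidable_on n (fun v => ~~ P v).
Proof.
move=> cP; apply: computable_ext (computable_sub (computable_const n 1) cP) => v _.
by case: (P v).
Qed.

Lemma decidable_and n P Q : decidable_on n P -> decidable_on n Q ->
  decidable_on n (fun v => P v && Q v).
Proof.
move=> cP cQ; apply: computable_ext (computable_mul cP cQ) => v _.
by case: (P v); case: (Q v).
Qed.

Lemma decidable_or n P Q : decidable_on n P -> decidable_on n Q ->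
  decidable_on n (fun v => P v || Q v).
Proof.
move=> cP cQ.
apply: computable_ext (decidable_not (decidable_and (decidable_not cP) (decidable_not cQ))).
by move=> v _; case: (P v); case: (Q v).
Qed.

Lemma decidable_le n F G : computable n F -> computable n G ->
  decidable_on n (fun v => F v <= G v).
Proof.
move=> cF cG.
apply: computable_ext (computable_sub (computable_const n 1) (computable_sub cF cG)) => v _.
by case: leqP; lia.
Qed.

Lemma decidable_lt n F G : computable n F -> computable n G ->
  decidable_on n (fun v => F v < G v).
Proof. by move=> cF cG; apply: decidable_le => //; exact: computable_succ. Qed.

Lemma decidable_eq n F G : computable n F -> computable n G ->
  decidable_on n (fun v => F v == G v).
Proof.
move=> cF cG; apply: computable_ext (decidable_and (decidable_le cF cG) (decidable_le cG cF)).
by move=> v _; rewrite -eqn_leq.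
Qed.

Lemma decidable_eqb n P Q : decidable_on n P -> decidable_on n Q ->
  decidable_on n (fun v => P v == Q v).
Proof.
move=> cF cG; apply: computable_ext (decidable_eq cF cG).
by move=> v _; case: (P v); case: (Q v).
Qed.

Lemma decidable_imp n P Q : decidable_on n P -> decidable_on n Q ->
  decidable_on n (fun v => P v ==> Q v).
Proof.
move=> cP cQ; apply: computable_ext (decidable_or (decidable_not cP) cQ) => v _.
by rewrite implybE.
Qed.

(** The sum of the truth values is positive exactly when one of them is true. *)
Lemma decidable_exists n F (P : nat -> seq nat -> bool) :
  computable n F -> decidable_on n.+1 (fun v => P (nth 0 v 0) (behead v)) ->
  decidable_on n (fun v => [exists i : 'I_(F v), P i v]).
Proof.
move=> cF cP.
apply: computable_ext (decidable_lt (computable_const n 0) (computable_sum (G := fun i v => P i v) cF cP)).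
move=> v _; congr nat_of_bool; rewrite lt0n sum_nat_eq0.
apply/forallPn/existsP => -[i Hi]; exists i; move: Hi; by case: (P i v).
Qed.

Lemma decidable_forall n F (P : nat -> seq nat -> bool) :
  computable n F -> decidable_on n.+1 (fun v => P (nth 0 v 0) (behead v)) ->
  decidable_on n (fun v => [forall i : 'I_(F v), P i v]).
Proof.
move=> cF cP.
have := decidable_not (decidable_exists (P := fun i v => ~~ P i v) cF (decidable_not cP)).
apply: computable_ext => v _; congr nat_of_bool; rewrite negb_exists.
by apply: eq_forallb => i; rewrite negbK.
Qed.

(** * Simplicity and chains described by words *)

Definition strict_total (T : eqType) (R : rel T) : Prop :=
  [/\ irreflexive R, transitive R & forall a b, a != b -> R a b || R b a].

Definition between (T : eqType) (R : rel T) (z a b : T) : bool :=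
  (R a z && R z b) || (R b z && R z a).

Definition sep (T : eqType) (X Y : rel T) (z a b : T) : bool :=
  between X z a b || between Y z a b.

(** The closed sets are those that no outside point separates. In a permutation these are the sets
    with contiguous positions and contiguous values. *)
Definition simple_orders (T : finType) (X Y : rel T) : Prop :=
  forall M : {set T},
    (forall a b z, a \in M -> b \in M -> sep X Y z a b -> z \in M) ->
    #|M| <= 1 \/ M = setT.

(** Patterns of length at most [m] pass from [T'] to [T], which is what keeps [T'] inside the class.
    [f] is chosen after [S], so points of [T] may be used again for other sets. *)
Definition small_embed (m : nat) (T' : finType) (X' Y' : rel T')
    (T : finType) (X Y : rel T) : Prop :=
  forall S : {set T'}, #|S| <= m -> exists f : T' -> T,
    {in S &, forall a b, X' a b = X (f a) (f b) /\ Y' a b = Y (f a) (f b)}.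

Definition large_simples (m : nat) (T : finType) (X Y : rel T) : Prop :=
  forall n, exists (T' : finType) (X' Y' : rel T'),
    [/\ strict_total X', strict_total Y', simple_orders X' Y',
        n <= #|T'| <= n + 10 & small_embed m X' Y' X Y].

Lemma strict_total_asym (T : eqType) (R : rel T) a b :
  strict_total R -> a != b -> R b a = ~~ R a b.
Proof.
case=> irr tr tot ab; have := tot a b ab.
case Rab: (R a b) => /=; last by [].
by move=> _; apply/negbTE/negP => Rba; have := tr _ _ _ Rab Rba; rewrite irr.
Qed.

Lemma betweenE (T : eqType) (R : rel T) z a b :
  strict_total R -> z != a -> z != b -> between R z a b = (R z a != R z b).
Proof.
move=> sR za zb; rewrite /between (strict_total_asym sR za) (strict_total_asym sR zb).
by case: (R z a); case: (R z b).
Qed.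

(** Separation by a further point becomes a comparison of two quadrants: the one of [z] around [a]
    and the one of [z] around [b]. *)
Lemma sepE (T : eqType) (X Y : rel T) z a b :
  strict_total X -> strict_total Y -> z != a -> z != b ->
  sep X Y z a b = ((X z a, Y z a) != (X z b, Y z b)).
Proof.
move=> sX sY za zb; rewrite /sep !betweenE // xpair_eqE.
by case: (_ == _); case: (_ == _).
Qed.

(** A chain point compares in one way with all earlier points except its predecessor. The letter
    [l i] stores this far comparison and then the near one, with position [i.-1]. The relation need
    not be transitive for an arbitrary word. *)
Definition word_rel (l : nat -> bool * bool) (i j : nat) : bool :=
  if j < i then (if j.+1 == i then (l i).2 else (l i).1)
  else if i < j then ~~ (if i.+1 == j then (l j).2 else (l j).1)
  else false.

Lemma word_rel_asym l i j : i != j -> word_rel l j i = ~~ word_rel l i j.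
Proof. by rewrite /word_rel; case: ltngtP => // _ _; rewrite negbK. Qed.

Lemma word_rel_far l i j : j.+1 < i -> word_rel l i j = (l i).1.
Proof. by rewrite /word_rel => ?; rewrite ifT ?ifF //; lia. Qed.

Lemma word_rel_near l i : word_rel l i.+1 i = (l i.+1).2.
Proof. by rewrite /word_rel ltnSn eqxx. Qed.

(** * Intervals of segments of a chain *)

Section ChainModules.

Context (w : nat -> (bool * bool) * (bool * bool)).
Let X := word_rel (fun i => (w i).1).
Let Y := word_rel (fun i => (w i).2).
Let far i := ((w i).1.1, (w i).2.1).
Let near i := ((w i).1.2, (w i).2.2).
Let tp i j := (X i j, Y i j).
Hypothesis far_near : forall i, 1 < i -> far i != near i.

Let tp_far i j : j.+1 < i -> tp i j = far i.
Proof. by move=> ji; rewrite /tp /X /Y !word_rel_far. Qed.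

Let tp_near i j : i = j.+1 -> tp i j = near i.
Proof. by move=> ->; rewrite /tp /X /Y !word_rel_near. Qed.

Let tp_flip i j k : k != i -> k != j -> tp k i = tp k j -> tp i k = tp j k.
Proof.
move=> ki kj; rewrite /tp /X /Y !(word_rel_asym _ ki) !(word_rel_asym _ kj).
by case=> -> ->.
Qed.

(** Intervals of the segment from [s] to [e]. *)
Let closed (M : nat -> bool) s e :=
  (forall i, M i -> s <= i <= e) /\
  (forall a b z, M a -> M b -> s <= z <= e -> ~~ M z -> tp z a = tp z b).

(** Records the shape of words that allows an interval missing only [s] (then [l] is [s.+1]) or only
    [s.+1] (then [l] is [s.+2]). *)
Let trouble s e := exists2 l, (l = s.+1 \/ l = s.+2) &
  far l <> far e /\ forall k, l < k <= e -> far k = far e.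

Let closed_flip M s e a b z : closed M s e ->
  M a -> M b -> s <= z <= e -> ~~ M z -> tp a z = tp b z.
Proof.
move=> [_ cM] Ma Mb ze Mz; apply: tp_flip (cM _ _ _ Ma Mb ze Mz).
  by apply: contraNneq Mz => ->.
by apply: contraNneq Mz => ->.
Qed.

(** The first position missing after [j] would see its predecessor and [i] in the same way, against
    [far_near]. *)
Let closed_up M s e i j : closed M s e -> 0 < s -> M i -> M j -> i < j ->
  forall k, j <= k <= e -> M k.
Proof.
move=> cM s0 Mi Mj ij; elim=> [|k IH] kj; first by have -> : 0 = j by lia.
have [<-//|jk] : j = k.+1 \/ j <= k by lia.
have Mk : M k by apply: IH; lia.
have /andP[si _] := cM.1 i Mi.
apply/negPn/negP => nM; have kse : s <= k.+1 <= e by lia.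
have l1 : 1 < k.+1 by lia.
have := cM.2 i k k.+1 Mi Mk kse nM.
rewrite (@tp_near k.+1 k) // tp_far; last by lia.
by move=> H; have := far_near l1; rewrite H eqxx.
Qed.

(** Let [i < j] be the two least elements. If [j] is [e], these two form the interval. Otherwise
    [closed_up] puts everything from [j] on into [M], and a proper interval can omit only [s] or
    only [s.+1]; the omitted point sees all of [M] alike, which causes trouble. *)
Let closed_cases M s e : closed M s e -> 0 < s -> s + 4 <= e ->
  (exists i j, [/\ M i, M j & i < j]) ->
  [\/ (forall k, s <= k <= e -> M k),
      trouble s e
    | exists2 i, s <= i < e & forall k, M k = (k == i) || (k == e)].
Proof.
move=> cM s0 se [i0 [j0 [Mi0 Mj0 ij0]]].
have exM : exists i, M i by exists i0.
case: (ex_minnP exM) => i Mi mini.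
have exM' : exists j, M j && (j != i).
  by exists j0; rewrite Mj0; have := mini _ Mi0; lia.
case: (ex_minnP exM') => j /andP[Mj ji] minj.
have ij : i < j by have := mini _ Mj; lia.
have /andP[si _] := cM.1 i Mi; have /andP[_ je] := cM.1 j Mj.
have Mlow k : k < j -> M k -> k = i.
  by move=> kj Mk; apply/eqP; apply: contraLR kj => ki; rewrite -leqNgt minj // Mk.
have [ej|je'] := eqVneq j e.
  subst e; apply: Or33; exists i; first by lia.
  move=> k; apply/idP/orP => [Mk|[/eqP->|/eqP->] //].
  have /andP[_ ke] := cM.1 k Mk.
  have [kj|kj] := ltnP k j; first by left; rewrite (Mlow k).
  by right; apply/eqP; lia.
have up := closed_up cM s0 Mi Mj ij.
have fl k a b : M a -> M b -> s <= k <= e -> ~~ M k -> tp a k = tp b k.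
  by move=> Ma Mb; exact: closed_flip cM Ma Mb.
case: (classic (forall k, s <= k <= e -> M k)) => [all|nall]; first exact: Or31.
apply: Or32.
have Me : M e by apply: up; lia.
have low k : s <= k -> k.+1 < j -> ~~ M k -> far j = far e /\ forall l, j <= l <= e -> far l = far e.
  move=> sk kj nMk.
  have H l : j <= l <= e -> far l = far e.
    move=> le; rewrite -(@tp_far l k); last lia.
    rewrite -(@tp_far e k); last lia.
    by apply: fl => //; [apply: up; lia | lia].
  by split=> //; apply: H; lia.
have [ji1|ji1] := eqVneq j.-1 i.
  have si' : s < i.
    rewrite ltn_neqAle si andbT; apply/eqP => e0; apply: nall => k ke.
    have [kj|kj] := ltnP k j; last by apply: up; lia.
    by have -> : k = i by lia.
  have nM k : k < i -> ~~ M k.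
    by move=> ki; apply/negP => /mini; lia.
  have H2 : far j = far e /\ forall l, j <= l <= e -> far l = far e.
    by apply: (low i.-1); rewrite ?nM //; lia.
  have Hn : near i = far j.
    rewrite -(@tp_near i i.-1); last lia.
    rewrite -(@tp_far j i.-1); last lia.
    by apply: fl => //; [lia | apply: nM; lia].
  have Hs : i = s.+1.
    have [//|si2] : i = s.+1 \/ s.+1 < i by lia.
    have : far i = near i.
      rewrite Hn -(@tp_far i i.-2); last lia.
      rewrite -(@tp_far j i.-2); last lia.
      by apply: fl => //; [lia | apply: nM; lia].
    by move=> H; have := @far_near i; rewrite H eqxx; lia.
  exists i; first by left.
  split; first by move=> H; have := @far_near i; rewrite Hn H H2.1 eqxx; lia.
  by move=> k ke; apply: H2.2; lia.
have nMj1 : ~~ M j.-1 by apply/negP => /Mlow; lia.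
have Hn l : j < l <= e -> near j = far l.
  move=> le; rewrite -(@tp_near j j.-1); last lia.
  rewrite -(@tp_far l j.-1); last lia.
  by apply: fl => //; [apply: up; lia | lia].
have full k : s <= k -> k.+1 < j -> M k.
  move=> sk kj; apply/negPn/negP => nMk; have [H1 _] := low k sk kj nMk.
  have := @far_near j; rewrite H1 (Hn e) ?eqxx; lia.
have Hs : i = s.
  by apply/esym/Mlow; [lia | apply: full; lia].
have Hj : j = s.+2.
  have [//|sj] : j = s.+2 \/ s.+2 < j by lia.
  have /Mlow : M s.+1 by apply: full; lia.
  lia.
exists j; first by right.
split; first by move=> H; have := @far_near j; rewrite H (Hn e) ?eqxx; lia.
by move=> k ke; rewrite -(Hn k) ?(Hn e) //; lia.
Qed.

(** Comparing the two pairs always yields a position ([i], [e] or [e.+1]) that sees its predecessor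
    as it sees an earlier position, against [far_near]. So a segment that fails because of a pair is
    repaired by one more point. *)
Let no_two_twins s e i i' : 0 < s -> s + 4 <= e -> s <= i < e -> s <= i' <= e ->
  closed (fun k => (k == i) || (k == e)) s e ->
  closed (fun k => (k == i') || (k == e.+1)) s e.+1 -> False.
Proof.
move=> s0 se ie ie' c1 c2.
have f1 k : s <= k < e -> k != i -> tp i k = tp e k.
  by move=> ke ki; apply: (closed_flip c1); rewrite ?eqxx ?orbT; lia.
have f2 k : s <= k <= e -> k != i' -> tp i' k = tp e.+1 k.
  by move=> ke ki; apply: (closed_flip c2); rewrite ?eqxx ?orbT; lia.
have fn k : 1 < k -> far k = near k -> False.
  by move=> k1 H; have := far_near k1; rewrite H eqxx.
have [ei|ei] := eqVneq i' e.
  subst i'; apply: (fn e); first lia.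
  rewrite -(@tp_far e e.-2); last lia.
  rewrite -(@tp_near e e.-1); last lia.
  rewrite (f2 e.-1) ?(f2 e.-2); try lia.
  by rewrite !tp_far //; lia.
have [ii|ii] := eqVneq i' i; last first.
  have H1 := f1 i' ltac:(lia) ii.
  have H2 := f2 i ltac:(lia) ltac:(by rewrite eq_sym).
  have H3 := f2 e ltac:(lia) ltac:(by rewrite eq_sym).
  apply: (fn e.+1); first lia.
  rewrite -(@tp_far e.+1 i); last lia.
  rewrite -(@tp_near e.+1 e) // -H2 -H3.
  by move: H1; rewrite /tp /X /Y !(word_rel_asym _ ii) (@word_rel_asym _ i' e) // (@word_rel_asym _ i' e) //; case=> /negb_inj -> /negb_inj ->.
subst i'.
have H k : s <= k < e -> k != i -> tp e k = far e.+1 /\ tp i k = far e.+1.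
  move=> ke ki; rewrite -(f1 k ke ki) (f2 k) ?tp_far //; lia.
have [ie1|ie1] := eqVneq i e.-1.
  apply: (fn i); first lia.
  rewrite -(@tp_far i i.-2); last lia.
  rewrite -(@tp_near i i.-1); last lia.
  by rewrite (H i.-2 _ _).2 ?(H i.-1 _ _).2 //; lia.
have [k [ke ki ke1]] : exists k, [/\ s <= k < e, k != i & k.+1 < e].
  by case: (eqVneq s i) => [si|si]; [exists s.+1 | exists s]; split; lia.
apply: (fn e); first lia.
rewrite -(@tp_far e k) // -(@tp_near e e.-1); last lia.
by rewrite (H k ke ki).1 (H e.-1 _ _).1 //; lia.
Qed.

(** Trouble at start 1 makes [far] constant after position 3 at the latest, whereas trouble at start
    3 needs a different value at position 4 or 5. *)
Let trouble_free n : 6 < n -> exists2 s, s = 1 \/ s = 3 &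
  ~ trouble s n /\ ~ trouble s n.+1.
Proof.
move=> n6.
have mono s : s = 1 \/ s = 3 -> trouble s n.+1 -> trouble s n.
  move=> s13 [l ls [l1 l2]]; have e : far n = far n.+1 by apply: l2; lia.
  by exists l => //; rewrite e; split=> // k kn; apply: l2; lia.
case: (classic (trouble 1 n)) => [t1|nt]; last first.
  by exists 1; [left | split=> // /mono; auto].
have nt : ~ trouble 3 n.
  case: t1 => l ls [l1 l2] [l' ls' [l1' _]]; apply: l1'; apply: l2; lia.
by exists 3; [right | split=> // /mono; auto].
Qed.

(** The segment starts at 1 or 3, to avoid trouble, and ends at [n + 7] or [n + 8], to avoid a pair;
    its length lies between [n + 5] and [n + 8]. *)
Lemma chain_word_simples n : strict_total X -> strict_total Y ->
  exists s k, n <= k <= n + 10 /\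
    simple_orders (fun i j : 'I_k => X (i + s) (j + s)) (fun i j : 'I_k => Y (i + s) (j + s)).
Proof.
move=> sX sY.
have [s s13 [nt nt']] := @trouble_free (n + 7) ltac:(lia).
pose good e := forall M, closed M s e -> (exists i j, [/\ M i, M j & i < j]) ->
  forall k, s <= k <= e -> M k.
have [e [e1 ge]] : exists e, n + 7 <= e <= n + 8 /\ good e.
  case: (classic (good (n + 7))) => [g|ng]; first by exists (n + 7); split=> //; lia.
  case: (classic (good (n + 8))) => [g|ng']; first by exists (n + 8); split=> //; lia.
  have tw e : ~ good e -> ~ trouble s e -> s + 4 <= e -> exists2 i, s <= i < e &
      closed (fun k => (k == i) || (k == e)) s e.
    move=> nge nte se; have [M ngM] := not_all_ex_not _ _ nge.
    have [cM {}ngM] := imply_to_and _ _ ngM.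
    have [exM {}ngM] := imply_to_and _ _ ngM.
    have [//|//|[i ie Me]] := closed_cases cM ltac:(lia) se exM.
    exists i => //; split=> [k|a b z]; first by rewrite -Me; exact: cM.1.
    by rewrite -!Me; exact: cM.2.
  have [i ie ci] := tw _ ng nt ltac:(lia).
  rewrite -(addnS n 7) in nt'.
  have [i' ie' ci'] := tw _ ng' nt' ltac:(lia).
  case: (@no_two_twins s (n + 7) i i' _ _ ie _ ci _); try lia.
  by rewrite -addnS.
exists s, (e.+1 - s); split; first lia.
move=> M cM; have [M1|M1] := leqP #|M| 1; first by left.
right; pose N k := [exists i in M, (i + s)%N == k].
have Ni (i : 'I_(e.+1 - s)) : N (i + s) = (i \in M).
  apply/exists_inP/idP => [[i' Mi' /eqP]|Mi]; last by exists i.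
  by move/addIn/val_inj <-.
have Nr k : N k -> s <= k <= e.
  by case/exists_inP => i _ /eqP <-; have := ltn_ord i; lia.
have toI z : s <= z <= e -> exists i : 'I_(e.+1 - s), z = i + s.
  move=> ze; have h : z - s < e.+1 - s by lia.
  by exists (Ordinal h) => /=; lia.
have cN : closed N s e.
  split=> [//|a b z Na Nb ze Nz].
  have [i iz] := toI _ ze; have [ia ia'] := toI _ (Nr _ Na); have [ib ib'] := toI _ (Nr _ Nb).
  subst z a b; move: Na Nb Nz; rewrite !Ni => Na Nb Nz.
  apply/eqP/negPn/negP => ne.
  have ni j : j \in M -> (i + s)%N != (j + s)%N.
    by move=> Mj; rewrite eqn_add2r; apply: contraNneq Nz => /val_inj ->.
  have H : sep X Y (i + s) (ia + s) (ib + s) by rewrite sepE ?ni.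
  by have := cM ia ib i Na Nb H; rewrite (negbTE Nz).
apply/setP => z; rewrite inE -Ni; apply: (ge N cN); last by have := ltn_ord z; lia.
case/card_gt1P: M1 => a [b [Ma Mb ab]].
have [ltab|ltba|/val_inj e0] := ltngtP a b.
- by exists (a + s), (b + s); rewrite !Ni; split=> //; lia.
- by exists (b + s), (a + s); rewrite !Ni; split=> //; lia.
- by rewrite e0 eqxx in ab.
Qed.

End ChainModules.

(** * Pumping *)

Section Pumping.

Context (A : finType).
Implicit Types (w : nat -> A) (n m : nat) (s : seq nat) (p : seq (A * bool)).

Definition adjacent n s := if s is i :: _ then n == i.+1 else false.

(* Position sets are listed in decreasing order, so that the head of a pattern
   describes the last position read. *)
Fixpoint pattern_at w s : seq (A * bool) :=
  if s is i :: s' then (w i, adjacent i s') :: pattern_at w s' else [::].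

(* [occurs w n p e]: some positions below [n] have pattern [p], the last one
   being [n.-1] iff [e]. *)
Fixpoint occurs w n p (e : bool) : bool :=
  if n is n'.+1 then
    if e then (if p is (a, b) :: p' then (a == w n') && occurs w n' p' b else false)
    else occurs w n' p false || occurs w n' p true
  else (p == [::]) && ~~ e.

Lemma size_pattern_at w s : size (pattern_at w s) = size s.
Proof. by elim: s => //= i s ->. Qed.

Lemma occurs_pattern_at w n s :
  path gtn n s -> occurs w n (pattern_at w s) (adjacent n s).
Proof.
elim: n s => [|n IH] [|i s] //=; first by rewrite (IH [::]).
move=> /andP[]; rewrite ltnS leq_eqVlt => /predU1P[-> ps|lin ps].
  by rewrite !eqxx; exact: IH.
have /= := IH (i :: s); rewrite /= ps lin eqSS => /(_ isT).
have -> : n == i = false by lia.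
by case: (n == i.+1) => ->; rewrite ?orbT.
Qed.

Lemma pattern_at_occurs w n p e : occurs w n p e ->
  exists s, [/\ path gtn n s, pattern_at w s = p & adjacent n s = e].
Proof.
elim: n p e => [|n IH] p e /=; first by case/andP => /eqP -> /negbTE ->; exists [::].
case: e => [|H].
  case: p => // -[a b] p /andP[/eqP -> /IH[s [ps <- <-]]].
  by exists (n :: s); rewrite /= eqxx ltnSn.
have {}H : exists s, path gtn n s /\ pattern_at w s = p.
  by case/orP: H => /IH[s [ps <- _]]; exists s.
case: H => [[|i s]] [/= ps <-]; first by exists [::].
by move: ps => /andP[lin ps]; exists (i :: s); split=> //=; [rewrite ps andbT | ]; lia.
Qed.

(** The number of sets of pairs consisting of a pattern of length at most [m] and a flag. Such a set
    is the state reached after a prefix: the arguments for which [occurs] holds there. *)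
Definition pump_states m := 2 ^ ((\sum_(i < m.+1) (#|A| * 2) ^ i) * 2).

(** Two prefixes reach the same state, and [w'] repeats the letters between them forever. Only
    prefixes of length at least 2 are compared, so letters 0 and 1, where nothing is known about
    near and far, are not repeated. *)
Lemma pumping m w L : pump_states m + 3 <= L -> exists w',
  (forall s, sorted gtn s -> size s <= m ->
     exists s', path gtn L s' /\ pattern_at w s' = pattern_at w' s) /\
  (forall i, 1 < i -> exists2 i', 1 < i' < L & w' i = w i').
Proof.
move=> KL; pose W := (m.-bseq (A * bool) * bool)%type.
pose state (i : 'I_(pump_states m).+1) : {set W} := [set x : W | occurs w (i + 2) x.1 x.2].
have /injectivePn [i [j ij eij]] : ~~ injectiveb state.
  apply/injectivePn/not_all_not_ex => H.
  have inj : injective state.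
    move=> i j e; apply/eqP/negPn/negP => ne; apply: (H i); exists j => //.
  have := leq_card state inj; rewrite card_ord.
  rewrite -cardsT -powersetT card_powerset cardsT card_prod card_bool card_bseq.
  by rewrite card_prod card_bool ltnn.
wlog ltij : i j ij eij / i < j.
  move=> H; case: (ltngtP i j) => [ltij|ltji|/val_inj e]; first exact: H ltij.
    by apply: (H j i) => //; rewrite eq_sym.
  by rewrite e eqxx in ij.
pose a := i + 2; pose d := j - i.
(* The place in [w] from which letter [t] of [w'] is copied: an initial part of length [a], then a
   loop of length [d]. *)
pose pos t := if t < a then t else a + (t - a) %% d.
have d0 : 0 < d by rewrite /d; lia.
have posL t : pos t < L.
  have := ltn_pmod (t - a) d0; have := ltn_ord j; rewrite /pos.
  by case: (ltnP t a); move: (_ %% _) => r; rewrite /a /d; lia.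
pose w' t := w (pos t).
have posS t : pos t.+1 = (pos t).+1 \/ pos t.+1 = a /\ (pos t).+1 = j + 2.
  rewrite /pos; case: (ltnP t a) => ta.
    case: (ltnP t.+1 a) => ta'; first by left.
    by left; have -> : t.+1 - a = 0; [lia | rewrite mod0n; lia].
  rewrite ifF; last by lia.
  rewrite subSn // -addn1 -modnDml.
  have := ltn_pmod (t - a) d0; set r := (_ %% d) => rd.
  have [rd1|rd1] : r + 1 < d \/ r + 1 = d by lia.
    by left; rewrite modn_small; lia.
  by right; rewrite rd1 modnn; rewrite /a /d in rd1 *; lia.
have key t p e : size p <= m -> occurs w' t p e = occurs w (pos t) p e.
  elim: t p e => [|t IH] p e sp.
    by have -> : pos 0 = 0 by rewrite /pos /a addn2.
  have step : occurs w' t.+1 p e = occurs w (pos t).+1 p e.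
    rewrite /= !(IH p) //; case: e => //; case: p sp => // -[x b] p sp.
    by rewrite IH //; exact: ltnW.
  rewrite step; case: (posS t) => [->//|[-> ->]].
  move/setP: eij => /(_ (Bseq sp, e)).
  by rewrite !inE.
exists w'; split=> [s ss sm|t t1].
  have [n ps] : exists n, path gtn n s.
    by case: s ss sm => [|k s] /= ps _; [exists 0 | exists k.+1; rewrite /gtn /= ltnSn].
  have := occurs_pattern_at w' ps; rewrite key ?size_pattern_at // => /pattern_at_occurs.
  case=> s' [ps' e _]; exists s'; split=> //.
  case: (s') ps' => //= k s'' /andP[kp ->]; rewrite andbT.
  by apply: ltn_trans (posL n).
exists (pos t) => //; rewrite posL andbT /pos /a.
by case: ifP; lia.
Qed.

End Pumping.

(** Listed positions can be consecutive integers only when they are neighbours in the list, and then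
    the flag tells. So letters and flags determine which half of a letter is read. *)
Lemma word_rel_pattern (A : finType) (w w' : nat -> A) (f : A -> bool * bool) s s' k l :
  sorted gtn s -> sorted gtn s' -> pattern_at w s = pattern_at w' s' ->
  k < size s -> l < size s ->
  word_rel (f \o w) (nth 0 s k) (nth 0 s l) = word_rel (f \o w') (nth 0 s' k) (nth 0 s' l).
Proof.
move=> ss ss' e; have es : size s = size s' by rewrite -(size_pattern_at w) e size_pattern_at.
have val v t i j : sorted gtn t -> i < j < size t -> nth 0 t j < nth 0 t i /\
   word_rel (f \o v) (nth 0 t i) (nth 0 t j) =
   let x := nth (v 0, false) (pattern_at v t) i in
   if (j == i.+1) && x.2 then (f x.1).2 else (f x.1).1.
  elim: i t j => [|i IH] [|a t] [|j] //= st; rewrite ?ltn0 ?andbF //; last first.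
    by move=> ?; apply: IH => //; exact: path_sorted st.
  rewrite ltnS => jt; rewrite eqSS.
  have at' k' : k' < size t -> nth 0 t k' < a.
    move=> kt; move: st; rewrite (path_sortedE (rev_trans ltn_trans)) => /andP[/allP H _].
    by apply: H; rewrite mem_nth.
  split; first exact: at'.
  rewrite /word_rel (at' _ jt) /=.
  case: t jt st at' => //= b t jt /andP[ba st] at'.
  case: j jt => [|j] jt /=; first by rewrite eq_sym.
  rewrite ifF //; apply/negbTE.
  have : nth 0 t j < b.
    move: st; rewrite (path_sortedE (rev_trans ltn_trans)) => /andP[/allP H _].
    by apply: H; rewrite mem_nth.
  by move: ba; rewrite /gtn /=; lia.
move=> ks ls; case: (ltngtP k l) => [kl|lk|->]; last by rewrite /word_rel !ltnn.
  rewrite (val w s k l ss _).2 ?(val w' s' k l ss' _).2 -?es ?kl ?ls //= e.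
  by congr (if _ && _ then _ else _); rewrite (set_nth_default (w 0, false)) ?size_pattern_at -?es.
have H1 := val w s l k ss; have H2 := val w' s' l k ss'.
rewrite -es lk ks in H2; rewrite lk ks in H1.
have [L1 {}H1] := H1 isT; have [L2 {}H2] := H2 isT.
rewrite (@word_rel_asym _ (nth 0 s l)); last by lia.
rewrite (@word_rel_asym _ (nth 0 s' l)); last by lia.
rewrite H1 H2 /= e.
by rewrite (set_nth_default (w 0, false) (w' 0, false)) ?size_pattern_at -?es.
Qed.

(** * Long chains *)

(* Pin sequences, without the requirement that a pin lie outside the rectangle
   spanned by its predecessors. *)
Definition chain (T : finType) (X Y : rel T) (a : T) (s : seq T) : Prop :=
  uniq (a :: s) /\
  forall i, 1 < i <= size s ->
    sep X Y (nth a (a :: s) i) (nth a (a :: s) i.-1) a /\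
    forall j, j.+1 < i -> ~~ sep X Y (nth a (a :: s) i) (nth a (a :: s) j) a.

Lemma chain_take (T : finType) (X Y : rel T) (a : T) s k :
  chain X Y a s -> chain X Y a (take k s).
Proof.
case=> us cs; split; first exact: (take_uniq k.+1 us).
move=> i ik.
have iks : i <= k /\ i <= size s by move: ik; rewrite size_take; case: ifP; lia.
have [|H1 H2] := cs i; first lia.
have e j : j <= i -> nth a (a :: take k s) j = nth a (a :: s) j.
  by case: j => //= j ji; rewrite nth_take //; lia.
split; first by rewrite !e //; lia.
by move=> j ji; rewrite !e ?H2 //; lia.
Qed.

Lemma chain_rcons (T : finType) (X Y : rel T) (a : T) s z :
  chain X Y a s -> z \notin a :: s -> 0 < size s ->
  (forall j, j < size s -> ~~ sep X Y z (nth a (a :: s) j) a) ->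
  sep X Y z (last a s) a -> chain X Y a (rcons s z).
Proof.
move=> [us cs] nz s0 H1 H2; split; first by rewrite -rcons_cons rcons_uniq nz.
move=> i; rewrite size_rcons => /andP[i1 isz].
have e j : j <= size s -> nth a (a :: rcons s z) j = nth a (a :: s) j.
  by move=> js; rewrite -rcons_cons nth_rcons /= ltnS js.
have [il|il] : i <= size s \/ i = (size s).+1 by lia.
  have [|c1 c2] := cs i; first by rewrite i1.
  by rewrite !e; try lia; split=> // j ji; rewrite e ?c2 //; lia.
rewrite il /= nth_rcons ltnn eqxx; split.
  by rewrite -/(nth a (a :: rcons s z) (size s)) e // nth_last /=.
by move=> j js; rewrite -/(nth a (a :: rcons s z) j) e ?H1 //; lia.
Qed.

Section Chains.

Context (T : finType) (X Y : rel T).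
Hypotheses (sX : strict_total X) (sY : strict_total Y).

(** Comparing with [a] yields the far letter, because a pin does not separate [a] from any point
    before its predecessor. *)
Definition pin_word (a : T) (s : seq T) (i : nat) : (bool * bool) * (bool * bool) :=
  let c := nth a (a :: s) in
  ((X (c i) a, X (c i) (c i.-1)), (Y (c i) a, Y (c i) (c i.-1))).

Lemma pin_wordE a s : chain X Y a s -> forall i j, i <= size s -> j <= size s ->
  word_rel (fun i => (pin_word a s i).1) i j = X (nth a (a :: s) i) (nth a (a :: s) j) /\
  word_rel (fun i => (pin_word a s i).2) i j = Y (nth a (a :: s) i) (nth a (a :: s) j).
Proof.
move=> [us cs]; have neq i j : i <= size s -> j <= size s -> i != j ->
   nth a (a :: s) i != nth a (a :: s) j by move=> *; rewrite nth_uniq.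
have lt i j : i <= size s -> j < i ->
  word_rel (fun i => (pin_word a s i).1) i j = X (nth a (a :: s) i) (nth a (a :: s) j) /\
  word_rel (fun i => (pin_word a s i).2) i j = Y (nth a (a :: s) i) (nth a (a :: s) j).
  move=> si ji; rewrite /word_rel ji; case: eqP => [<-//|ji1].
  have {}ji1 : j.+1 < i by lia.
  have [|_ /(_ j ji1)] := cs i; first lia.
  rewrite sepE ?neq //; try lia; first by rewrite negbK => /eqP[-> ->].
  by apply: (neq i 0) => //; lia.
move=> i j si sj; case: (ltngtP i j) => [ij|ji|->]; last 2 first.
- exact: lt.
- by case: sX sY => [irX _ _] [irY _ _]; rewrite /word_rel !ltnn irX irY.
have nij : i != j by lia.
have ncij := neq i j si sj nij; rewrite eq_sym in nij; rewrite eq_sym in ncij.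
rewrite !(@word_rel_asym _ j i) //.
rewrite (strict_total_asym sX ncij) (strict_total_asym sY ncij).
by have [-> ->] := lt j i sj ij.
Qed.

Lemma long_chain_large_simples m a s : 2 < m -> chain X Y a s ->
  pump_states ((bool * bool) * (bool * bool))%type m + 2 <= size s ->
  large_simples m X Y.
Proof.
move=> m2 ch Ls; pose L := (size s).+1.
have [|w [emb far_near]] := @pumping _ m (pin_word a s) L.
  by rewrite /L addnS ltnS.
clear Ls.
have femb l : size l <= m -> exists f : nat -> T, {in l &, forall i j,
    word_rel (fun i => (w i).1) i j = X (f i) (f j) /\
    word_rel (fun i => (w i).2) i j = Y (f i) (f j)}.
  move=> lm; pose t := sort geq (undup l).
  have st : sorted gtn t.
    rewrite gtn_sorted_uniq_geq sort_uniq undup_uniq /=.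
    by apply: sort_sorted => i j; exact: leq_total.
  have tm : size t <= m by rewrite size_sort (leq_trans (size_undup _)).
  have [t' [pt' e]] := emb t st tm.
  have szt : size t' = size t by rewrite -(size_pattern_at (pin_word a s)) e size_pattern_at.
  exists (fun i => nth a (a :: s) (nth 0 t' (index i t))) => i j il jl.
  have it : i \in t by rewrite mem_sort mem_undup.
  have jt : j \in t by rewrite mem_sort mem_undup.
  have bnd x : x \in t -> nth 0 t' (index x t) <= size s.
    move=> xt; move: pt'; rewrite (path_sortedE (rev_trans ltn_trans)) => /andP[/allP H _].
    have /H : nth 0 t' (index x t) \in t' by rewrite mem_nth // szt index_mem.
    by rewrite /gtn /= /L ltnS.
  have [<- <-] := pin_wordE ch (bnd _ it) (bnd _ jt).
  rewrite -{1 3}(nth_index 0 it) -{1 3}(nth_index 0 jt).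
  by split; [apply: (word_rel_pattern fst) | apply: (word_rel_pattern snd)];
    rewrite ?index_mem //; exact: path_sorted pt'.
(* Transitivity concerns three positions, and any three of the pumped word embed into [T]; this is
   the use of [2 < m]. *)
have st p : (p = fst \/ p = snd) -> strict_total (word_rel (fun i => p (w i))).
  move=> Hp; split.
  - by move=> i; rewrite /word_rel !ltnn.
  - move=> j i k; have [f Hf] := femb [:: i; j; k] m2.
    have [_ trX _] := sX; have [_ trY _] := sY.
    have inl : [/\ i \in [:: i; j; k], j \in [:: i; j; k] & k \in [:: i; j; k]].
      by rewrite !inE !eqxx !orbT.
    case: inl => ii jj kk.
    have [x1 y1] := Hf i j ii jj; have [x2 y2] := Hf j k jj kk; have [x3 y3] := Hf i k ii kk.
    by case: Hp => ->; [rewrite x1 x2 x3; exact: trX | rewrite y1 y2 y3; exact: trY].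
  - by move=> i j ij; rewrite (word_rel_asym _ ij) orbN.
have stX := st fst (or_introl erefl); have stY := st snd (or_intror erefl).
have fn i : 1 < i -> ((w i).1.1, (w i).2.1) != ((w i).1.2, (w i).2.2).
  move=> i1; have [i' i'L ->] := far_near i i1.
  have {}i'L : 1 < i' <= size s by rewrite /L in i'L; lia.
  have [us cs] := ch; have [+ _] := cs i' i'L.
  have neq j : j < i' -> nth a (a :: s) i' != nth a (a :: s) j.
    by move=> ji; rewrite nth_uniq ?us //=; lia.
  rewrite sepE //; first by rewrite eq_sym.
    by apply: neq; lia.
  by apply: (neq 0); lia.
move=> n; have [s0 [k [kn pr]]] := chain_word_simples fn n stX stY.
exists 'I_k, (fun i j : 'I_k => word_rel (fun i => (w i).1) (i + s0) (j + s0)),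
  (fun i j : 'I_k => word_rel (fun i => (w i).2) (i + s0) (j + s0)).
have shift (R : rel nat) : strict_total R -> strict_total (fun i j : 'I_k => R (i + s0) (j + s0)).
  case=> ir tr tot; split=> [i|j i l|i j ij]; rewrite ?ir //; first exact: tr.
  by apply: tot; rewrite eqn_add2r.
split; rewrite ?card_ord //; try exact: shift.
move=> S Sm; pose l := [seq (val i + s0)%N | i <- enum S].
have [f Hf] := femb l ltac:(by rewrite size_map -cardE).
exists (fun i : 'I_k => f (i + s0)) => i j iS jS.
by apply: Hf; apply: map_f; rewrite mem_enum.
Qed.

End Chains.

(** * Chains in simple permutations *)

Lemma finset_of_prop (T : finType) (P : T -> Prop) :
  exists M : {set T}, forall v, v \in M <-> P v.
Proof.
have [f Hf] : exists f : T -> bool, forall v, f v <-> P v.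
  apply: (@fin_all_exists T (fun=> bool) (fun v b => b <-> P v)) => v.
  by case: (classic (P v)) => Pv; [exists true | exists false]; split.
by exists [set v | f v] => v; rewrite inE.
Qed.

Lemma nat_choice (T : Type) (x : T) n (P : nat -> T -> Prop) :
  (forall i, i < n -> exists y, P i y) -> exists f, forall i, i < n -> P i (f i).
Proof.
elim: n => [|n IH] H; first by exists (fun=> x).
have [f Hf] := IH (fun i lin => H i (ltnW lin)).
have [y Hy] := H n (ltnSn n).
exists (fun i => if i == n then y else f i) => i; rewrite ltnS leq_eqVlt.
by case: eqVneq => [->|_ /= /Hf].
Qed.

Section StrictTotal.

Context (T : eqType) (R : rel T).
Hypothesis sR : strict_total R.

Lemma strict_total_le_lt b a c : ~~ R b a -> R b c -> R a c.
Proof.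
case: (eqVneq a b) => [->//|ab]; rewrite (strict_total_asym sR ab) negbK.
by case: sR => _ tr _; exact: tr.
Qed.

Lemma strict_total_lt_le b a c : R a b -> ~~ R c b -> R a c.
Proof.
case: (eqVneq b c) => [->//|bc]; rewrite (strict_total_asym sR bc) negbK.
by case: sR => _ tr _; exact: tr.
Qed.

Lemma strict_total_ltNge a b : R a b -> ~~ R b a.
Proof.
move=> ab; apply/negP => ba; case: sR => ir tr _.
by have := tr _ _ _ ab ba; rewrite ir.
Qed.

Lemma strict_total_lt_neq a b : R a b -> a != b.
Proof. by case: sR => ir _ _; apply: contraTneq => ->; rewrite ir. Qed.

Lemma strict_total_inv : strict_total (fun a b => R b a).
Proof.
case: sR => ir tr tot; split=> // [b a c ba cb|a b ab]; first exact: tr cb ba.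
by rewrite orbC; exact: tot.
Qed.

End StrictTotal.

Lemma between_inv (T : eqType) (R : rel T) z a b :
  between (fun x y => R y x) z a b = between R z a b.
Proof. by rewrite /between orbC [X in X || _]andbC [X in _ || X]andbC. Qed.

Section SimpleChains.

Context (T : finType) (X Y : rel T).
Hypotheses (sX : strict_total X) (sY : strict_total Y).

(** The points reached from [a], [b] by chains, together with [a], form a closed set: a point
    separating two of them separates one of them from [a], and then it prolongs an initial part of
    the chain leading there. *)
Lemma simple_chain a b v : simple_orders X Y -> a != b -> v != a ->
  exists s, chain X Y a (b :: s) /\ last b s = v.
Proof.
move=> simp ab va; pose reach v := v = a \/ exists s, chain X Y a (b :: s) /\ last b s = v.
have [M MP] := finset_of_prop reach.
have aM : a \in M by apply/MP; left.
have bM : b \in M.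
  apply/MP; right; exists [::]; split=> //; split; first by rewrite /= inE ab.
  by case=> [|[|i]].
have Mclosed x y z : x \in M -> y \in M -> sep X Y z x y -> z \in M.
  move=> xM yM sz; apply/negPn/negP => zM.
  have zn t : t \in M -> z != t by move=> tM; apply: contraNneq zM => ->.
  have [t tM st] : exists2 t, t \in M & sep X Y z t a.
    case xa : (sep X Y z x a); first by exists x.
    exists y => //; move: sz xa; rewrite !sepE ?zn // => sz /negbFE /eqP e.
    by rewrite eq_sym -e.
  have saa : ~~ sep X Y z a a by rewrite sepE ?zn ?eqxx.
  case/MP: (tM) => [ta|[s [cs lt]]]; first by rewrite ta (negbTE saa) in st.
  (* The chain is cut at the first point that [z] separates from [a]. Thus [z] separates no earlier
     point from [a], as a pin must. *)
  have exk : exists k, (k <= size (b :: s)) && sep X Y z (nth a (a :: b :: s) k) a.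
    by exists (size (b :: s)); rewrite leqnn -[X in nth _ X]/(a :: (b :: s)) nth_last /= lt.
  case: (ex_minnP exk) => k /andP[ks sk] mink.
  have k0 : 0 < k by case: k ks sk {mink} => //=; rewrite (negbTE saa).
  apply/negP: zM; apply/negPn; apply/MP; right.
  case: k ks sk mink k0 => // k ks sk mink _.
  have sz' : size (take k.+1 (b :: s)) = k.+1 by rewrite size_takel.
  have nt j : j <= k.+1 -> nth a (a :: take k.+1 (b :: s)) j = nth a (a :: b :: s) j.
    by case: j => // j jk; rewrite -[LHS]/(nth a (take k.+1 (b :: s)) j) nth_take.
  have reach_nth j : j <= k.+1 -> nth a (a :: b :: s) j \in M.
    case: j => // j jk; apply/MP; right; exists (take j s); split.
      by rewrite -[b :: take j s]/(take j.+1 (b :: s)); exact: chain_take.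
    case: j jk => [|j] jk; first by rewrite take0.
    rewrite /= ltnS in ks.
    have js : j.+1 <= size s by rewrite ltnS in jk; exact: leq_trans jk ks.
    by rewrite -(nth_last b) size_takel //= nth_take //; exact: set_nth_default.
  exists (rcons (take k s) z); rewrite last_rcons; split=> //.
  rewrite -rcons_cons -[b :: take k s]/(take k.+1 (b :: s)).
  apply: chain_rcons; rewrite ?sz' //.
  - exact: chain_take.
  - apply/negP => /(nthP a) [j]; rewrite -[size _]/(size (take k.+1 (b :: s))).+1 sz' ltnS => jk e.
    by have := zn _ (reach_nth j jk); rewrite -nt //= e eqxx.
  - move=> j jk; rewrite nt; last exact: ltnW.
    apply/negP => sj; have := mink j; rewrite sj andbT => H.
    by have := H (ltnW (leq_trans jk ks)); rewrite ltnNge -ltnS jk.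
  - rewrite -(nth_last a) sz' /=.
    have := nt k.+1 (leqnn _); rewrite /= => e.
    by rewrite (set_nth_default a) ?e //; move: sz' => /= ->.
have [|e] := simp M Mclosed.
  by rewrite leqNgt; case/negP; apply/card_gt1P; exists a, b.
have : v \in M by rewrite e inE.
by case/MP => // e'; rewrite e' eqxx in va.
Qed.

End SimpleChains.

(** * Monotone sequences and far cuts *)

Section ErdosSzekeres.

Context (T : eqType) (R : rel T).
Hypothesis sR : strict_total R.

(** The left-to-right minima of [s] lying below [m], so that [m :: records m s] descends. *)
Fixpoint records (m : T) (s : seq T) : seq T :=
  if s is x :: s' then if R x m then x :: records x s' else records m s' else [::].

Fixpoint nonrecords (m : T) (s : seq T) : seq T :=
  if s is x :: s' then if R x m then nonrecords x s' else x :: nonrecords m s'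
  else [::].

Lemma path_records m s : path (fun x y => R y x) m (records m s).
Proof. by elim: s m => //= x s IH m; case: ifP => //= ->; exact: IH. Qed.

Lemma subseq_records m s : subseq (records m s) s.
Proof.
elim: s m => //= x s IH m; case: ifP => _; first by rewrite eqxx.
exact: subseq_trans (IH m) (subseq_cons _ _).
Qed.

Lemma subseq_nonrecords m s : subseq (nonrecords m s) s.
Proof.
elim: s m => //= x s IH m; case: ifP => _; last by rewrite eqxx.
exact: subseq_trans (IH x) (subseq_cons _ _).
Qed.

Lemma size_records m s : size (records m s) + size (nonrecords m s) = size s.
Proof.
by elim: s m => //= x s IH m; have := IH x; have := IH m; case: ifP => _ /=; lia.
Qed.

(** When a nonrecord is read, the current minimum is an earlier and smaller element. *)
Lemma nonrecords_extend m s y t : uniq (m :: s) -> subseq (y :: t) (nonrecords m s) ->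
  exists2 z, R z y & subseq (z :: y :: t) (m :: s).
Proof.
elim: s m y t => //= x s IH m y t; rewrite inE negb_or => /and3P[/andP[mx ms] xs us].
case: ifP => Rxm.
  move=> /IH[|z zy sz]; first by rewrite xs.
  by exists z => //; exact: (@subseq_trans _ (x :: s) [:: z, y & t] (m :: x :: s) sz (subseq_cons _ _)).
rewrite /=; case: eqVneq => [->|yx] st.
  exists m; last first.
    by rewrite !eqxx; exact: subseq_trans st (subseq_nonrecords _ _).
  by rewrite (strict_total_asym sR (a := x)) ?Rxm // eq_sym.
have [|z zy sz] := IH m y t _ st; first by rewrite ms.
exists z => //; move: sz => /=; case: eqVneq => // _ sz.
  by case: eqVneq => [e|_] //; apply: subseq_trans sz; exact: subseq_cons.
by case: eqVneq => [e|_] //; apply: subseq_trans sz; exact: subseq_cons.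
Qed.

(** Induction on [a]. If [m] and its records number at most [b], the nonrecords still exceed the
    bound for the preceding [a], and an ascending sequence found there gains one element in
    front. *)
Lemma erdos_szekeres a b s : uniq s -> a * b < size s ->
  (exists t, [/\ subseq t s, sorted R t & a < size t]) \/
  (exists t, [/\ subseq t s, sorted (fun x y => R y x) t & b < size t]).
Proof.
elim: a s => [|a IH] [|m s] us //= sab.
  by left; exists [:: m]; rewrite /= eqxx sub0seq.
have [sr|sr] := ltnP b (size (records m s)).+1.
  right; exists (m :: records m s).
  by rewrite /= eqxx subseq_records path_records.
have := size_records m s => sz.
have unr : uniq (nonrecords m s).
  by apply: subseq_uniq (subseq_nonrecords m s) _; case/andP: us.
have [|[t [st ot la]]|[t [st ot lb]]] := IH (nonrecords m s) unr; try lia.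
  left; case: t st ot la => // y t st ot la.
  have [z zy sz'] := nonrecords_extend us st.
  by exists (z :: y :: t); split=> //; rewrite /= zy.
right; exists t; split=> //.
exact: subseq_trans st (subseq_trans (subseq_nonrecords m s) (subseq_cons _ _)).
Qed.

End ErdosSzekeres.

Lemma sorted_enum (T : finType) (R : rel T) : strict_total R ->
  exists s, sorted R s /\ perm_eq s (enum T).
Proof.
move=> sR; pose le a b := ~~ R b a.
have tot : total le.
  move=> a b; rewrite /le; case: (eqVneq a b) => [->|ab]; last first.
    by rewrite (strict_total_asym sR ab) negbK orbN.
  by case: sR => ->.
exists (sort le (enum T)); split; last by rewrite perm_sort.
have := sort_sorted tot (enum T).
have : uniq (sort le (enum T)) by rewrite sort_uniq enum_uniq.
elim: (sort _ _) => // a [|b s] IH // /andP[ns us] /andP[ab pb] /=.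
have {}IH : path R b s := IH us pb.
rewrite IH andbT; move: ns; rewrite inE negb_or => /andP[nab _].
by move: ab; rewrite /le (strict_total_asym sR nab) negbK.
Qed.

Definition increasing (T : Type) (X Y : rel T) (n : nat) (u : nat -> T) : Prop :=
  forall i j, i < j <= n -> X (u i) (u j) /\ Y (u i) (u j).

Lemma sorted_nth_lt (T : eqType) (R : rel T) (x : T) s i j :
  strict_total R -> sorted R s -> i < j < size s -> R (nth x s i) (nth x s j).
Proof.
case=> _ tr _ ss ij; apply: (sorted_ltn_nth tr x ss); rewrite ?inE; lia.
Qed.

Lemma monotone_points (T : finType) (X Y : rel T) n :
  strict_total X -> strict_total Y -> n * n < #|T| ->
  exists u, increasing X Y n u \/ increasing X (fun a b => Y b a) n u.
Proof.
move=> sX sY nT; have [s [ss ps]] := sorted_enum sX.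
have us : uniq s by rewrite (perm_uniq ps) enum_uniq.
have szs : n * n < size s by rewrite (perm_size ps) -cardE.
have x0 : T by case: s szs {ss ps us}.
have trX : transitive X by case: sX.
have [[t [st ot la]]|[t [st ot la]]] := erdos_szekeres sY us szs;
  exists (nth x0 t); [left | right] => i j ij.
  split; apply: sorted_nth_lt; rewrite ?(subseq_sorted trX st ss) //; lia.
split; first by apply: sorted_nth_lt; rewrite ?(subseq_sorted trX st ss) //; lia.
have ijs : i < j < size t by lia.
exact: (sorted_nth_lt x0 (strict_total_inv sY) ot ijs).
Qed.

(** * Chains confined to windows of an increasing sequence *)

Section Windows.

Context (T : finType) (X Y : rel T).
Hypotheses (sX : strict_total X) (sY : strict_total Y).

Definition in_box (u v z : T) : bool :=
  [&& ~~ X z u, ~~ X v z, ~~ Y z u & ~~ Y v z].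

(* [z t] cuts the [t]-th of the consecutive boxes spanned by [u] from outside
   the box spanned by all of [u]. *)
Definition far_cuts (n : nat) : Prop :=
  exists u z : nat -> T, increasing X Y n u /\
    forall t, t < n ->
      [&& X (u t) (z t), X (z t) (u t.+1) & Y (z t) (u 0) || Y (u n) (z t)] ||
      [&& Y (u t) (z t), Y (z t) (u t.+1) & X (z t) (u 0) || X (u n) (z t)].

(** Induction on [i]: a window of length [Q ^ i.+1] splits into [Q] windows of length [Q ^ i], each
    with a start whose chains of [i] further points stay in the small box. If each of these starts
    has a chain with one more point that leaves the large box, the last points of these chains are
    [Q] far cuts. *)
Lemma window_chains (u : nat -> T) N Q i a : increasing X Y N u -> 0 < Q ->
  a + Q ^ i <= N ->
  far_cuts Q \/
  exists2 s, a <= s < a + Q ^ i & forall r, chain X Y (u s) (u s.+1 :: r) ->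
    size r <= i -> all (in_box (u a) (u (a + Q ^ i))) [:: u s, u s.+1 & r].
Proof.
move=> inc Q0; have [irX trX _] := sX; have [irY trY _] := sY.
have leX j k : j <= k <= N -> ~~ X (u k) (u j).
  move=> jk; case: (eqVneq j k) => [->|njk]; first by rewrite irX.
  by apply: (strict_total_ltNge sX); apply: (inc _ _ _).1; lia.
have leY j k : j <= k <= N -> ~~ Y (u k) (u j).
  move=> jk; case: (eqVneq j k) => [->|njk]; first by rewrite irY.
  by apply: (strict_total_ltNge sY); apply: (inc _ _ _).2; lia.
have box_sub j j' k k' z : j' <= j -> j <= k -> k <= k' -> k' <= N ->
    in_box (u j) (u k) z -> in_box (u j') (u k') z.
  move=> j1 j2 j3 j4 /and4P[x1 x2 x3 x4].
  have jj : j' <= j <= N by lia.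
  have kk : k <= k' <= N by lia.
  apply/and4P; split; apply/negP => H.
  - by have := strict_total_lt_le sX H (leX _ _ jj); rewrite (negbTE x1).
  - by have := strict_total_le_lt sX (leX _ _ kk) H; rewrite (negbTE x2).
  - by have := strict_total_lt_le sY H (leY _ _ jj); rewrite (negbTE x3).
  - by have := strict_total_le_lt sY (leY _ _ kk) H; rewrite (negbTE x4).
elim: i a => [|i IH] a aN.
  right; exists a; first by rewrite expn0; lia.
  move=> [|//] _ _; rewrite expn0 addn1 in aN *.
  by rewrite /= /in_box !irX !irY !leX ?leY //; lia.
have sub t : t < Q -> a + t * Q ^ i + Q ^ i <= a + Q ^ i.+1.
  by move=> tQ; rewrite -addnA leq_add2l -mulSnr expnS leq_mul2r tQ orbT.
case: (classic (far_cuts Q)) => [|nfar]; first by left.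
right; apply: NNPP => nex; apply: (nfar).
pose v t := u (a + t * Q ^ i).
have Qi0 : 0 < Q ^ i by rewrite expn_gt0 Q0.
have [z Hz] : exists z, forall t, t < Q ->
    [&& X (v t) (z t), X (z t) (v t.+1) & Y (z t) (v 0) || Y (v Q) (z t)] ||
    [&& Y (v t) (z t), Y (z t) (v t.+1) & X (z t) (v 0) || X (v Q) (z t)].
  apply: (@nat_choice _ (u 0) Q (fun t x =>
    [&& X (v t) x, X x (v t.+1) & Y x (v 0) || Y (v Q) x] ||
    [&& Y (v t) x, Y x (v t.+1) & X x (v 0) || X (v Q) x])) => t tQ.
  have [/nfar //|[s sa Hs]] := IH (a + t * Q ^ i) (leq_trans (sub t tQ) aN).
  have vS : u (a + t * Q ^ i + Q ^ i) = v t.+1 by rewrite /v mulSnr addnA.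
  have inbig x : in_box (v t) (v t.+1) x -> in_box (u a) (u (a + Q ^ i.+1)) x.
    apply: box_sub; first by rewrite leq_addr.
    - by rewrite leq_add2l leq_mul2r leqnSn orbT.
    - by rewrite mulSnr addnA; exact: sub.
    - exact: aN.
  have [r [cr ri nr]] : exists r, [/\ chain X Y (u s) (u s.+1 :: r), size r <= i.+1 &
      ~~ all (in_box (u a) (u (a + Q ^ i.+1))) [:: u s, u s.+1 & r]].
    apply: NNPP => nr; case: nex; exists s; first by have := sub t tQ; lia.
    move=> r cr ri; apply/negPn/negP => nall; case: nr; exists r; split=> //.
  have {}Hs r' x : chain X Y (u s) (u s.+1 :: r') -> size r' <= i ->
      x \in [:: u s, u s.+1 & r'] -> in_box (v t) (v t.+1) x.
    by move=> cr' ri' xr; rewrite -vS; apply: (allP (Hs r' cr' ri')).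
  case/lastP: r cr ri nr => [|r' x] cr ri /allPn[y].
    by move=> yr; rewrite inbig // (Hs [::]).
  rewrite size_rcons ltnS in ri.
  have cr' : chain X Y (u s) (u s.+1 :: r').
    have := chain_take (size r').+1 cr.
    by rewrite /= -cats1 take_size_cat.
  rewrite -!rcons_cons mem_rcons inE => /predU1P[->|yr]; last first.
    by rewrite inbig //; exact: Hs cr' ri yr.
  (* [x] separates its predecessor from [u s]. Both lie in the small box, so [x] is within its range
     in one order, and being outside the large box it must be so in the other order. *)
  move=> nx; exists x.
  have [_ /(_ (size r').+2)] := cr.
  rewrite -rcons_cons size_rcons /= leqnn => /(_ isT)[+ _].
  rewrite nth_rcons ltnn eqxx -[nth _ (_ :: _) _]/(nth (u s) [:: u s, u s.+1 & rcons r' x] (size r').+1).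
  rewrite -!rcons_cons nth_rcons /= ltnSn.
  have -> : nth (u s) (u s.+1 :: r') (size r') = last (u s.+1) r'.
    by rewrite (set_nth_default (u s.+1)) ?nth_last.
  have /and4P[] := Hs r' (last (u s.+1) r') cr' ri ltac:(by rewrite inE mem_last orbT).
  have /and4P[] := Hs r' (u s) cr' ri (mem_head _ _).
  move: (last _ _) (u s) => p q x1 x2 y1 y2 x1' x2' y1' y2'.
  have vQ : v Q = u (a + Q ^ i.+1) by rewrite /v expnS.
  have v0 : v 0 = u a by rewrite /v addn0.
  rewrite vQ v0; move: nx; rewrite /in_box.
  have cutX : between X x p q -> X (v t) x && X x (v t.+1).
    case/orP => /andP[H1 H2]; apply/andP; split.
    - exact: (strict_total_le_lt sX x1' H1).
    - exact: (strict_total_lt_le sX H2 x2).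
    - exact: (strict_total_le_lt sX x1 H1).
    - exact: (strict_total_lt_le sX H2 x2').
  have cutY : between Y x p q -> Y (v t) x && Y x (v t.+1).
    case/orP => /andP[H1 H2]; apply/andP; split.
    - exact: (strict_total_le_lt sY y1' H1).
    - exact: (strict_total_lt_le sY H2 y2).
    - exact: (strict_total_le_lt sY y1 H1).
    - exact: (strict_total_lt_le sY H2 y2').
  have tQ' : a <= a + t * Q ^ i <= N.
    rewrite leq_addr; apply: leq_trans (leq_trans _ (sub t tQ)) aN; exact: leq_addr.
  have tQ'' : a + t.+1 * Q ^ i <= a + Q ^ i.+1 <= N.
    by rewrite mulSnr addnA (sub t tQ).
  move=> nbox /orP[/cutX/andP[H1 H2]|/cutY/andP[H1 H2]]; apply/orP; [left|right].
    rewrite H1 H2 /=; move: nbox.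
    have -> : X x (u a) = false.
      apply/negbTE/(strict_total_ltNge sX); exact: (strict_total_le_lt sX (leX _ _ tQ') H1).
    have -> : X (u (a + Q ^ i.+1)) x = false.
      apply/negbTE/(strict_total_ltNge sX); exact: (strict_total_lt_le sX H2 (leX _ _ tQ'')).
    by rewrite /= negb_and !negbK.
  rewrite H1 H2 /=; move: nbox.
  have -> : Y x (u a) = false.
    apply/negbTE/(strict_total_ltNge sY); exact: (strict_total_le_lt sY (leY _ _ tQ') H1).
  have -> : Y (u (a + Q ^ i.+1)) x = false.
    apply/negbTE/(strict_total_ltNge sY); exact: (strict_total_lt_le sY H2 (leY _ _ tQ'')).
  by rewrite /= andbT negb_and !negbK.
exists v, z; split=> // j k jk; apply: inc.
case/andP: jk => jk kQ; rewrite ltn_add2l ltn_mul2r Qi0 jk /=.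
by apply: leq_trans aN; rewrite leq_add2l expnS leq_mul2r kQ orbT.
Qed.

End Windows.

(** * Alternations *)

Definition coord_rel (T : Type) (x : T -> nat) : rel T := fun a b => x a < x b.

Lemma coord_rel_strict_total (T : eqType) (x : T -> nat) :
  injective x -> strict_total (coord_rel x).
Proof.
move=> inj; split=> [a|b a c|a b ab]; rewrite /coord_rel ?ltnn //; first exact: ltn_trans.
by rewrite -neq_ltn (inj_eq inj).
Qed.

Lemma coord_simple (T : finType) (x y : T -> nat) :
  (forall M : {set T},
    (forall a b z, a \in M -> b \in M -> x a < x z < x b -> z \in M) ->
    (forall a b z, a \in M -> b \in M -> y a < y z < y b -> z \in M) ->
    forall u v z, u \in M -> v \in M -> u != v -> z \in M) ->
  simple_orders (coord_rel x) (coord_rel y).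
Proof.
move=> H M cM; case: (leqP #|M| 1) => [|/card_gt1P[u [v [uM vM uv]]]]; first by left.
right; apply/setP => z; rewrite inE; apply: (H M _ _ u v) => // a b t aM bM ab; apply: (cM a b) => //.
  by rewrite /sep /between /coord_rel ab.
by rewrite /sep /between /coord_rel ab orbT.
Qed.

(* Only the relative order of the row indices matters, so the rows met by a
   small subset can be moved to the first [m] rows. *)
Lemma small_embed_rows m (T' : finType) (x y idx : T' -> nat) (T : finType)
    (X Y : rel T) (F : T' -> nat -> T) :
  injective x -> injective y -> strict_total X -> strict_total Y ->
  (forall u v k l, k < m -> l < m ->
    [\/ idx u < idx v /\ k < l, idx u = idx v /\ k = l | idx v < idx u /\ l < k] ->
    (x u < x v -> X (F u k) (F v l)) /\ (y u < y v -> Y (F u k) (F v l))) ->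
  small_embed m (coord_rel x) (coord_rel y) X Y.
Proof.
move=> ix iy sX sY H S Sm.
pose r k := #|[set u in S | idx u < k]|.
have rlt u v : u \in S -> idx u < idx v -> r (idx u) < r (idx v).
  move=> uS uv; apply: proper_card; apply/properP; split.
    by apply/subsetP => t; rewrite !inE => /andP[-> tu]; apply: ltn_trans tu uv.
  by exists u; rewrite !inE ?uS ?uv ?ltnn.
have rm u : u \in S -> r (idx u) < m.
  move=> uS; apply: leq_trans Sm; apply: proper_card; apply/properP; split.
    by apply/subsetP => t; rewrite !inE => /andP[].
  by exists u; rewrite // !inE uS ltnn.
exists (fun u => F u (r (idx u))).
have homo u v : u \in S -> v \in S ->
    (x u < x v -> X (F u (r (idx u))) (F v (r (idx v)))) /\
    (y u < y v -> Y (F u (r (idx u))) (F v (r (idx v)))).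
  move=> uS vS; apply: H; rewrite ?rm //.
  case: (ltngtP (idx u) (idx v)) => [uv|vu|->]; last exact: Or32.
    by apply: Or31; split=> //; exact: rlt.
  by apply: Or33; split=> //; exact: rlt.
have [irX _ _] := sX; have [irY _ _] := sY.
move=> u v uS vS; have [x1 y1] := homo u v uS vS; have [x2 y2] := homo v u vS uS.
rewrite /coord_rel; split.
  case: ltngtP x1 x2 => [_ ->//|_ _|/ix -> _ _]; last by rewrite irX.
  by move=> /(_ isT)/(strict_total_ltNge sX)/negbTE ->.
case: ltngtP y1 y2 => [_ ->//|_ _|/iy -> _ _]; last by rewrite irY.
by move=> /(_ isT)/(strict_total_ltNge sY)/negbTE ->.
Qed.

Lemma pair_ord_inj N (i j : 'I_N) (c : bool) : (i : nat) = j -> (i, c) = (j, c).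
Proof. by move/val_inj ->. Qed.

Section Alternations.

Context (T : finType) (X Y : rel T) (m : nat).
Hypotheses (sX : strict_total X) (sY : strict_total Y).
Variables (a b : nat -> T).

(** From left to right the points run [a 0], [b 0], [a 1], [b 1] and so on. The points [b] rise and
    stay below all points [a]; the vertical order among the points [a] is left open. *)
Definition zigzag (X Y : rel T) (m : nat) (a b : nat -> T) : Prop :=
  forall i j, i < m -> j < m ->
    [/\ X (a i) (b i), i < j -> X (b i) (a j), i < j -> Y (b i) (b j) & Y (b i) (a j)].

Hypothesis zz : zigzag X Y m a b.

Lemma zigzag_X i j : i < m -> j < m ->
  [/\ i < j -> X (a i) (a j), i < j -> X (b i) (b j) & i <= j -> X (a i) (b j)].
Proof.
move=> im jm; have [_ trX _] := sX.
have [x1 x2 _ _] := zz im jm; have [x3 _ _ _] := zz jm jm.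
split=> ij.
- exact: trX x1 (x2 ij).
- exact: trX (x2 ij) x3.
- case: ltngtP ij => // [ij _|-> _] //; exact: trX x1 (trX _ _ _ (x2 ij) x3).
Qed.

(** Two points of one row trap a point of the other row between them. One point of each row forces,
    by height, the first [a] and the last [b]; these are the leftmost and the rightmost point, so
    everything follows. *)
Lemma parallel_large_simples :
  (forall i j, i < j < m -> Y (a i) (a j)) -> large_simples m X Y.
Proof.
move=> up n; pose N := n./2.+2.
pose x (u : 'I_N * bool) : nat := if u.2 then u.1.*2 else u.1.*2.+1.
pose y (u : 'I_N * bool) : nat := if u.2 then N + u.1 else u.1.
have ix : injective x.
  by move=> [i []] [j []]; rewrite /x /= => e; (try by apply: pair_ord_inj; lia); lia.
have iy : injective y.
  by move=> [i []] [j []]; rewrite /y /= => e; have := ltn_ord i; have := ltn_ord j;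
    (try by move=> _ _; apply: pair_ord_inj; lia); lia.
exists ('I_N * bool)%type, (coord_rel x), (coord_rel y); split.
- exact: coord_rel_strict_total.
- exact: coord_rel_strict_total.
- apply: coord_simple => M cx cy u v t uM vM uv.
  have step i j : (i, true) \in M -> (j, false) \in M -> t \in M.
    move=> iM jM.
    have a0 : (ord0, true) \in M.
      case: (eqVneq i ord0) iM => [<-//|i0 iM]; apply: (cy _ _ _ jM iM).
      by move: i0; rewrite /y -val_eqE /= ; have := ltn_ord j; lia.
    have bN : (ord_max, false) \in M.
      case: (eqVneq j ord_max) jM => [<-//|j0 jM]; apply: (cy _ _ _ jM iM).
      by move: j0; rewrite /y -val_eqE /= ; have := ltn_ord j; lia.
    case: (eqVneq t (ord0, true)) => [->//|t0]; case: (eqVneq t (ord_max, false)) => [->//|t1].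
    apply: (cx _ _ _ a0 bN); move: t0 t1; case: t => -[i' Hi] []; rewrite /x /= -!(inj_eq ix) /x /=; lia.
  have xm (i j : 'I_N) c : (i, c) \in M -> (j, c) \in M -> i < j -> t \in M.
    move=> iM jM ij; case: c iM jM => iM jM.
      by apply: (step i i) => //; apply: (cx _ _ _ iM jM); rewrite /x /=; lia.
    by apply: (step j j) => //; apply: (cx _ _ _ iM jM); rewrite /x /=; lia.
  case: u v uM vM uv => [i c] [j d] uM vM uv.
  case: c d uM vM uv => -[] uM vM uv.
  + case: (ltngtP i j) uv => [ij _|ji _|/val_inj ->]; [exact: (xm _ _ _ uM vM ij)|exact: (xm _ _ _ vM uM ji)|by rewrite eqxx].
  + exact: (step i j).
  + exact: (step j i).
  + case: (ltngtP i j) uv => [ij _|ji _|/val_inj ->]; [exact: (xm _ _ _ uM vM ij)|exact: (xm _ _ _ vM uM ji)|by rewrite eqxx].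
- by rewrite card_prod card_ord card_bool /N; lia.
apply: (small_embed_rows (idx := fun u : 'I_N * bool => u.1 : nat)
  (F := fun (u : 'I_N * bool) k => if u.2 then a k else b k)) => //.
move=> [i c] [j d] k l km lm; have := ltn_ord i; have := ltn_ord j; rewrite /x /y /=.
have [z1 z2 z3 z4] := zz km lm; have [z5 z6 z7] := zigzag_X km lm.
have z8 := up k l; clear - km lm z1 z2 z3 z4 z5 z6 z7 z8.
case: c; case: d => /= jN iN [] [ij kl]; split=> H;
  solve [ by clear - jN iN ij H; lia | by apply: z2 | by apply: z3 | by apply: z5
    | by apply: z6 | by apply: z8; rewrite kl | by apply: z7; rewrite ?kl // ltnW | exact: z4 ].
Qed.

Hypothesis down : forall i j, i < j < m -> Y (a j) (a i).

(** The wedge has its tip on the right. Alone it is not simple: the two points at the tip form an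
    interval, and [a 0] is a corner. A point [w] at the open end, at a height between the two rows,
    separates the tip and lies to the left of [a 0]. *)
Lemma wedge_inner_large_simples w :
  (forall i, i < m -> [/\ X w (a i), X w (b i), Y (b i) w & Y w (a i)]) ->
  large_simples m X Y.
Proof.
move=> hw n; pose N := n./2.+2.
pose x (u : option ('I_N * bool)) : nat :=
  if u is Some (i, c) then if c then i.*2.+1 else i.*2.+2 else 0.
pose y (u : option ('I_N * bool)) : nat :=
  if u is Some (i, c) then if c then N.*2 - i else i else N.
have ix : injective x.
  by move=> [[i []]|] [[j []]|]; rewrite /x // => e;
    (try by congr Some; apply: pair_ord_inj; lia); lia.
have iy : injective y.
  by move=> [[i []]|] [[j []]|]; rewrite /y // => e;
    try (have := ltn_ord i); try (have := ltn_ord j);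
    (try by move=> *; congr Some; apply: pair_ord_inj; lia); lia.
exists (option ('I_N * bool))%type, (coord_rel x), (coord_rel y); split.
- exact: coord_rel_strict_total.
- exact: coord_rel_strict_total.
- apply: coord_simple => M cx cy u v t uM vM uv.
  pose A i := Some (i, true) : option ('I_N * bool).
  pose B i := Some (i, false) : option ('I_N * bool).
  have step j : None \in M -> B j \in M -> t \in M.
    move=> wM jM.
    have a0 : A ord0 \in M by apply: (cx _ _ _ wM jM).
    have aM k : A k \in M.
      case: (eqVneq k ord0) => [->//|k0]; apply: (cy _ _ _ wM a0).
      by move: k0; rewrite /y /= -val_eqE /=; have := ltn_ord k; rewrite /N; lia.
    have bM (k : 'I_N) : k < N.-1 -> B k \in M.
      by move=> kN; apply: (cx _ _ _ wM (aM ord_max)); rewrite /x /=; lia.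
    have b0 : B ord0 \in M by apply: bM.
    have bN : B ord_max \in M.
      by apply: (cy _ _ _ b0 wM); rewrite /y /= /N; lia.
    case: t => [[k []]|//]; first exact: aM.
    have [kN|kN] := ltnP k N.-1; first exact: bM.
    have -> // : k = ord_max by apply/val_inj; move: kN => /=; have := ltn_ord k; lia.
  have stepA i : None \in M -> A i \in M -> t \in M.
    move=> wM iM; case: (eqVneq i ord0) iM => [->|i0] iM; last first.
      apply: (step ord0) => //; apply: (cx _ _ _ wM iM).
      by move: i0; rewrite /x /= -val_eqE /=; lia.
    have aN : A ord_max \in M.
      by apply: (cy _ _ _ wM iM); rewrite /y /= /N; lia.
    by apply: (step ord0) => //; apply: (cx _ _ _ wM aN).
  have stepAB i j : A i \in M -> B j \in M -> t \in M.
    move=> iM jM; apply: (step j) => //; apply: (cy _ _ _ jM iM).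
    by rewrite /y /=; have := ltn_ord i; have := ltn_ord j; lia.
  have stepAA (i j : 'I_N) : A i \in M -> A j \in M -> i < j -> t \in M.
    move=> iM jM ij; apply: (stepAB i i) => //; apply: (cx _ _ _ iM jM).
    by rewrite /x /=; lia.
  have stepBB (i j : 'I_N) : B i \in M -> B j \in M -> i < j -> t \in M.
    move=> iM jM ij; apply: (stepAB j j) => //; apply: (cx _ _ _ iM jM).
    by rewrite /x /=; lia.
  case: u uM uv => [[i []]|]; case: v vM => [[j []]|] vM uM uv.
  + case: (ltngtP i j) uv => [ij _|ji _|/val_inj ->]; [exact: (stepAA _ _ uM vM)|exact: (stepAA _ _ vM uM)|by rewrite eqxx].
  + exact: (stepAB i j).
  + exact: (stepA i).
  + exact: (stepAB j i).
  + case: (ltngtP i j) uv => [ij _|ji _|/val_inj ->]; [exact: (stepBB _ _ uM vM)|exact: (stepBB _ _ vM uM)|by rewrite eqxx].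
  + exact: (step i).
  + exact: (stepA j).
  + exact: (step j).
  + by rewrite eqxx in uv.
- by rewrite card_option card_prod card_ord card_bool /N; lia.
apply: (small_embed_rows (idx := fun u : option ('I_N * bool) => if u is Some (i, _) then i : nat else 0)
  (F := fun (u : option ('I_N * bool)) k => if u is Some (_, c) then if c then a k else b k else w)) => //.
move=> u v k l km lm.
have [z1 z2 z3 z4] := zz km lm; have [z5 z6 z7] := zigzag_X km lm.
have z8 := @down l k; have [w1 w2 w3 w4] := hw _ lm; have [w5 w6 w7 w8] := hw _ km.
rewrite /x /y.
case: u => [[i c]|]; case: v => [[j d]|] /=; last by rewrite !ltnn.
- have := ltn_ord i; have := ltn_ord j; clear - km lm z1 z2 z3 z4 z5 z6 z7 z8.
  case: c; case: d => /= jN iN [] [ij kl]; split=> H;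
  solve [ by clear - jN iN ij H; lia | by apply: z2 | by apply: z3 | by apply: z5
    | by apply: z6 | by apply: z8; rewrite kl | by apply: z7; rewrite ?kl // ltnW | exact: z4 ].
- have := ltn_ord i; clear - w5 w6 w7 w8; case: c => iN _; split=> H //; exfalso; clear - iN H; lia.
- have := ltn_ord j; clear - w1 w2 w3 w4; case: d => jN _; split=> H //; exfalso; clear - jN H; lia.
Qed.

(** Here [q], beyond the tip at a height between the rows, separates the two points of the tip. The
    point [v] separates [q] from the wedge horizontally, and lying above everything it keeps [a 0]
    from being a corner. *)
Lemma wedge_outer_large_simples v q :
  (forall i, i < m -> [/\ X (b i) v, Y (b i) q, Y q (a i) & Y (a i) v]) ->
  X v q -> large_simples m X Y.
Proof.
move=> hv vq n; pose N := n./2.+2.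
pose x (u : option (option ('I_N * bool))) : nat :=
  match u with Some (Some (i, c)) => if c then i.*2 else i.*2.+1
  | None => N.*2 | Some None => N.*2.+1 end.
pose y (u : option (option ('I_N * bool))) : nat :=
  match u with Some (Some (i, c)) => if c then N.*2 - i else i
  | None => N.*2.+1 | Some None => N end.
have ix : injective x.
  by move=> [[[i []]|]|] [[[j []]|]|]; rewrite /x // => e;
    try (have := ltn_ord i); try (have := ltn_ord j);
    (try by move=> *; congr (Some (Some _)); apply: pair_ord_inj; lia); lia.
have iy : injective y.
  by move=> [[[i []]|]|] [[[j []]|]|]; rewrite /y // => e;
    try (have := ltn_ord i); try (have := ltn_ord j);
    (try by move=> *; congr (Some (Some _)); apply: pair_ord_inj; lia); lia.
exists (option (option ('I_N * bool)))%type, (coord_rel x), (coord_rel y); split.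
- exact: coord_rel_strict_total.
- exact: coord_rel_strict_total.
- apply: coord_simple => M cx cy u u' t uM vM uv.
  pose A i := Some (Some (i, true)) : option (option ('I_N * bool)).
  pose B i := Some (Some (i, false)) : option (option ('I_N * bool)).
  have step : Some None \in M -> None \in M -> t \in M.
    move=> qM nM.
    have a0 : A ord0 \in M by apply: (cy _ _ _ qM nM); rewrite /y /= /N; lia.
    case: (eqVneq t (A ord0)) => [->//|t0].
    case: (eqVneq t (Some None)) => [->//|t1].
    apply: (cx _ _ _ a0 qM); case: t t0 t1 => [[[k []]|]|] //.
    + by rewrite /x /A /= -(inj_eq ix) /x /=; have := ltn_ord k; clear; lia.
    + by rewrite /x /A /=; have := ltn_ord k; clear; lia.
    + by rewrite /x /A /= /N; lia.
  have stepA i : A i \in M -> Some None \in M -> t \in M.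
    move=> iM qM; apply: step => //; apply: (cx _ _ _ iM qM).
    by rewrite /x /=; have := ltn_ord i; clear; lia.
  have stepB i : B i \in M -> Some None \in M -> t \in M.
    move=> iM qM; apply: step => //; apply: (cx _ _ _ iM qM).
    by rewrite /x /=; have := ltn_ord i; clear; lia.
  have stepAB i j : A i \in M -> B j \in M -> t \in M.
    move=> iM jM; apply: (stepA i) => //; apply: (cy _ _ _ jM iM).
    by rewrite /y /=; have := ltn_ord i; have := ltn_ord j; clear; lia.
  have stepAA (i j : 'I_N) : A i \in M -> A j \in M -> i < j -> t \in M.
    move=> iM jM ij; apply: (stepAB i i) => //; apply: (cx _ _ _ iM jM).
    by rewrite /x /=; clear -ij; lia.
  have stepBB (i j : 'I_N) : B i \in M -> B j \in M -> i < j -> t \in M.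
    move=> iM jM ij; apply: (stepAB j j) => //; apply: (cx _ _ _ iM jM).
    by rewrite /x /=; clear -ij; lia.
  have stepNA i : None \in M -> A i \in M -> t \in M.
    move=> nM iM; apply: (stepAB i i) => //; apply: (cx _ _ _ iM nM).
    by rewrite /x /=; have := ltn_ord i; clear; lia.
  have stepNB i : None \in M -> B i \in M -> t \in M.
    move=> nM iM; apply: (stepB i) => //; apply: (cy _ _ _ iM nM).
    by rewrite /y /=; have := ltn_ord i; rewrite /N; clear; lia.
  case: u uM uv => [[[i []]|]|]; case: u' vM => [[[j []]|]|] vM uM uv.
  + case: (ltngtP i j) uv => [ij _|ji _|/val_inj ->]; [exact: (stepAA _ _ uM vM)|exact: (stepAA _ _ vM uM)|by rewrite eqxx].
  + exact: (stepAB i j).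
  + exact: (stepA i).
  + exact: (stepNA i).
  + exact: (stepAB j i).
  + case: (ltngtP i j) uv => [ij _|ji _|/val_inj ->]; [exact: (stepBB _ _ uM vM)|exact: (stepBB _ _ vM uM)|by rewrite eqxx].
  + exact: (stepB i).
  + exact: (stepNB i).
  + exact: (stepA j).
  + exact: (stepB j).
  + by rewrite eqxx in uv.
  + exact: step.
  + exact: (stepNA j).
  + exact: (stepNB j).
  + exact: step.
  + by rewrite eqxx in uv.
- by rewrite !card_option card_prod card_ord card_bool /N; lia.
apply: (small_embed_rows
  (idx := fun u : option (option ('I_N * bool)) => if u is Some (Some (i, _)) then i : nat else 0)
  (F := fun (u : option (option ('I_N * bool))) k =>
    match u with Some (Some (_, c)) => if c then a k else b k
    | None => v | Some None => q end)) => //.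
move=> u u' k l km lm.
have [z1 z2 z3 z4] := zz km lm; have [z5 z6 z7] := zigzag_X km lm.
have trans (R : rel T) : strict_total R -> transitive R by case.
have [z9 _ _ _] := zz lm lm.
have z8 := @down l k; have [w1 w3 w5 w7] := hv _ lm; have [w2 w4 w6 w8] := hv _ km.
have qv : Y q v := trans _ sY _ _ _ w6 w8.
have akv : X (a k) v := trans _ sX _ _ _ z1 w2.
have akq : X (a k) q := trans _ sX _ _ _ akv vq.
have bkq : X (b k) q := trans _ sX _ _ _ w2 vq.
have bkv : Y (b k) v := trans _ sY _ _ _ w4 qv.
have alv : X (a l) v := trans _ sX _ _ _ z9 w1.
have alq : X (a l) q := trans _ sX _ _ _ alv vq.
have blq : X (b l) q := trans _ sX _ _ _ w1 vq.
have blv : Y (b l) v := trans _ sY _ _ _ w3 qv.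
rewrite /x /y.
case: u => [[[i c]|]|]; case: u' => [[[j d]|]|] /=; try by [].
- have := ltn_ord i; have := ltn_ord j; clear - km lm z1 z2 z3 z4 z5 z6 z7 z8.
  case: c; case: d => /= jN iN [] [ij kl]; split=> H;
  solve [ by clear - jN iN ij H; lia | by apply: z2 | by apply: z3 | by apply: z5
    | by apply: z6 | by apply: z8; rewrite kl | by apply: z7; rewrite ?kl // ltnW | exact: z4 ].
- have := ltn_ord i; case: c => iN _; split=> H //; exfalso; clear - iN H; lia.
- have := ltn_ord i; case: c => iN _; split=> H //; exfalso; clear - iN H; lia.
- have := ltn_ord j; case: d => jN _; split=> H //; exfalso; clear - jN H; lia.
- by move=> _; split; rewrite ltnn.
- move=> _; split=> H //; exfalso; clear - H; lia.
- have := ltn_ord j; case: d => jN _; split=> H //; exfalso; clear - jN H; lia.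
- move=> _; split=> H //; exfalso; clear - H; lia.
- by move=> _; split; rewrite ltnn.
Qed.

End Alternations.

(** * Wedges *)

Lemma zigzag_sub (T : finType) (X Y : rel T) M m a b (g : nat -> nat) :
  zigzag X Y M a b -> (forall i j, i < j < m -> g i < g j) -> (forall i, i < m -> g i < M) ->
  zigzag X Y m (a \o g) (b \o g).
Proof.
move=> zz gm gM i j im jm; have [x1 x2 x3 x4] := zz _ _ (gM i im) (gM j jm).
by split=> //= ij; [apply: x2 | apply: x3]; apply: gm; rewrite ij.
Qed.

Lemma simple_orders_invY (T : finType) (X Y : rel T) :
  simple_orders X Y -> simple_orders X (fun a b => Y b a).
Proof.
move=> simp M cM; apply: simp => a b z aM bM sz; apply: (cM a b) => //.
by move: sz; rewrite /sep (between_inv Y).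
Qed.

Lemma simple_orders_swap (T : finType) (X Y : rel T) :
  simple_orders X Y -> simple_orders Y X.
Proof.
move=> simp M cM; apply: simp => a b z aM bM sz; apply: (cM a b) => //.
by move: sz; rewrite /sep orbC.
Qed.

Lemma large_simples_invY m (T : finType) (X Y : rel T) :
  large_simples m X (fun a b => Y b a) -> large_simples m X Y.
Proof.
move=> H n; have [T' [X' [Y' [h1 h2 h3 h4 h5]]]] := H n.
exists T', X', (fun x y => Y' y x); split=> //; first exact: strict_total_inv.
  exact: simple_orders_invY.
move=> S Sm; have [f Hf] := h5 S Sm; exists f => x y xS yS.
by split; [apply: (Hf x y xS yS).1 | apply: (Hf y x yS xS).2].
Qed.

Lemma large_simples_swap m (T : finType) (X Y : rel T) :
  large_simples m Y X -> large_simples m X Y.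
Proof.
move=> H n; have [T' [X' [Y' [h1 h2 h3 h4 h5]]]] := H n.
exists T', Y', X'; split=> //; first exact: simple_orders_swap.
move=> S Sm; have [f Hf] := h5 S Sm; exists f => x y xS yS.
by have [] := Hf x y xS yS.
Qed.

Section Wedges.

Context (T : finType) (X Y : rel T).
Hypotheses (sX : strict_total X) (sY : strict_total Y).
Variables (M : nat) (a b : nat -> T).
Hypotheses (zz : zigzag X Y M a b) (down : forall i j, i < j < M -> Y (a j) (a i)).

(* The strip of rows [s, e] is not met by the vertical and the horizontal line
   through [c]. *)
Definition clear_of (s e : nat) (c : T) : bool :=
  (X c (a s) || X (b e) c) &&
  [|| Y c (b s), Y (b e) c && Y c (a e) | Y (a s) c].

Let leX i j : i <= j < M -> ~~ X (a j) (a i) /\ ~~ X (b j) (b i).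
Proof.
move=> /andP[ij jM]; have iM : i < M := leq_ltn_trans ij jM.
have [irX _ _] := sX; case: (ltngtP i j) ij => // [ij _|-> _]; last by rewrite !irX.
by have [H1 H2 _] := zigzag_X sX zz iM jM; split; apply: (strict_total_ltNge sX); auto.
Qed.

Let leY i j : i <= j < M -> ~~ Y (b j) (b i) /\ ~~ Y (a i) (a j).
Proof.
move=> /andP[ij jM]; have iM : i < M := leq_ltn_trans ij jM.
have [irY _ _] := sY; case: (ltngtP i j) ij => // [ij _|-> _]; last by rewrite !irY.
have [_ _ H _] := zz iM jM; split; apply: (strict_total_ltNge sY); first exact: H.
by apply: down; rewrite ij.
Qed.

Let clear_sub s s' e e' c : s <= s' -> s' <= e' -> e' <= e -> e < M ->
  clear_of s e c -> clear_of s' e' c.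
Proof.
move=> ss se ee eM /andP[HX HY].
have ss' : s <= s' < M by rewrite ss (leq_ltn_trans se (leq_ltn_trans ee eM)).
have ee' : e' <= e < M by rewrite ee.
have [xa _] := leX ss'; have [_ xb] := leX ee'.
have [yb ya] := leY ss'; have [yb' ya'] := leY ee'.
apply/andP; split.
  case/orP: HX => H; first by rewrite (strict_total_lt_le sX H xa).
  by rewrite (strict_total_le_lt sX xb H) orbT.
case/or3P: HY => [H|/andP[H1 H2]|H].
- by rewrite (strict_total_lt_le sY H yb).
- by rewrite (strict_total_le_lt sY yb' H1) (strict_total_lt_le sY H2 ya') orbT.
- by rewrite (strict_total_le_lt sY ya H) !orbT.
Qed.

(** Each of the two lines through [c] meets at most one of three consecutive blocks of rows, so one
    block escapes both. *)
Let clear_third s L c : 0 < L -> s + 3 * L <= M ->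
  exists2 t, t < 3 & clear_of (s + t * L) (s + t * L + L.-1) c.
Proof.
move=> L0 sM.
have bad_X t t' : t < t' < 3 ->
   (X c (a (s + t * L)) || X (b (s + t * L + L.-1)) c) ||
   (X c (a (s + t' * L)) || X (b (s + t' * L + L.-1)) c).
  move=> tt; set e := s + t * L + L.-1; set s' := s + t' * L.
  have es : e < s' < M by rewrite /e /s'; nia.
  have [_ H _ _] := @zz e s' ltac:(lia) ltac:(lia).
  case H1 : (X (b e) c); first by rewrite orbT.
  have -> : X c (a s') by apply: (strict_total_le_lt sX (negbT H1)); apply: H; lia.
  by rewrite orbT.
have bad_Y t t' : t < t' < 3 ->
   [|| Y c (b (s + t * L)), Y (b (s + t * L + L.-1)) c && Y c (a (s + t * L + L.-1)) | Y (a (s + t * L)) c] ||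
   [|| Y c (b (s + t' * L)), Y (b (s + t' * L + L.-1)) c && Y c (a (s + t' * L + L.-1)) | Y (a (s + t' * L)) c].
  move=> tt; set e := s + t * L + L.-1; set s' := s + t' * L.
  have es : e < s' < M by rewrite /e /s'; nia.
  have [_ _ H _] := @zz e s' ltac:(lia) ltac:(lia).
  have dn := @down e s' ltac:(lia).
  case H1 : (Y (b e) c); last first.
    have -> : Y c (b s') by apply: (strict_total_le_lt sY (negbT H1)); apply: H; lia.
    by rewrite orbT.
  case H2 : (Y c (a e)); first by rewrite orbT.
  have -> : Y (a s') c by apply: (strict_total_lt_le sY dn); rewrite H2.
  by rewrite !orbT.
have [t01 t02 t12] : [/\ 0 < 1 < 3, 0 < 2 < 3 & 1 < 2 < 3] by [].
have := bad_X _ _ t01; have := bad_X _ _ t02; have := bad_X _ _ t12.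
have := bad_Y _ _ t01; have := bad_Y _ _ t02; have := bad_Y _ _ t12.
case C0 : (clear_of (s + 0 * L) (s + 0 * L + L.-1) c); first by exists 0.
case C1 : (clear_of (s + 1 * L) (s + 1 * L + L.-1) c); first by exists 1.
case C2 : (clear_of (s + 2 * L) (s + 2 * L + L.-1) c); first by exists 2.
move: C0 C1 C2; rewrite /clear_of.
do 3 (case: (X _ _ || X _ _) => /=); do 3 (case: [|| _, _ | _] => //=).
Qed.

Let clear_window (cs : seq T) s L : 0 < L -> s + L * 3 ^ size cs <= M ->
  exists s', [/\ s <= s', s' + L <= s + L * 3 ^ size cs &
    forall c, c \in cs -> clear_of s' (s' + L.-1) c].
Proof.
move=> L0; elim: cs s => [|c cs IH] s; first by exists s; split=> //; rewrite muln1.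
rewrite [size _]/= expnS mulnCA; set L' := L * _ => sM.
have L'0 : 0 < L' by rewrite muln_gt0 L0 expn_gt0.
have [t t3 ct] := clear_third c L'0 sM.
have tL : s + t * L' + L' <= s + 3 * L'.
  by rewrite -addnA leq_add2l -mulSnr leq_mul2r t3 orbT.
have [s' [ss sL cl]] := IH _ (leq_trans tL sM).
have LL' : s' + L <= s + t * L' + L' by exact: sL.
exists s'; split.
- exact: leq_trans (leq_addr _ _) ss.
- exact: leq_trans LL' tL.
move=> d; rewrite inE => /predU1P[->|]; last exact: cl.
apply: clear_sub ct => //; move: LL' ss tL sM; move: (s + t * L') (s + 3 * L') => k l; lia.
Qed.

(** A chain leads from the tip back to [a 0]. It is short, and each of its points costs a factor 3,
    so [m.+1] consecutive rows remain clear of all its points. The place where the chain leaves the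
    region beyond these rows supplies the extra point or points. *)
Lemma wedge_large_simples m K : simple_orders X Y ->
  (forall c s, chain X Y c s -> size s < K) -> 0 < m -> m.+1 * 3 ^ K <= M ->
  large_simples m X Y.
Proof.
move=> simp short m0 MK.
have M1 : 1 < M.
  by apply: leq_trans MK; rewrite -[2]muln1 leq_mul ?expn_gt0.
pose l := M.-1; have lM : l < M by rewrite /l; lia.
have [xl xl' _ yl] := zz lM lM.
have ab : a l != b l by apply: (strict_total_lt_neq sX).
have al : a 0 != a l.
  by have [H _ _] := zigzag_X sX zz (ltnW M1) lM; apply: (strict_total_lt_neq sX); apply: H; rewrite /l; lia.
have [r [cr lr]] := simple_chain sX sY simp ab al.
pose cs := a l :: b l :: r.
have szK : size cs <= K by exact: short cr.
have M3 : 0 + m.+1 * 3 ^ size cs <= M.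
  by apply: leq_trans MK; rewrite leq_mul2l leq_exp2l // szK orbT.
have [s [_ sM cl]] := clear_window (ltn0Sn m) M3.
rewrite /= in cl; set e := s + m in cl.
have eM : e < M by move: (leq_trans sM M3); rewrite /e; lia.
have sM' : s < M by rewrite /e in eM; lia.
(* The region beyond the clear rows towards the tip, at a height between the two sides. *)
pose inner c := X (b e) c && (Y (b e) c && Y c (a e)).
have [asX bsX] := @leX s l ltac:(rewrite /l; lia).
have [bsY asY] := @leY s l ltac:(rewrite /l; lia).
have [xs _ _ ys] := zz sM' lM; have [_ _ _ ys'] := zz lM sM'.
have in_a : inner (a l).
  have : clear_of s e (a l) by apply: cl; rewrite inE eqxx.
  rewrite /clear_of (negbTE asX) (negbTE asY) /= orbF => /andP[x1 /orP[H|H]].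
    by have := strict_total_ltNge sY H; rewrite ys.
  by rewrite /inner x1.
have in_b : inner (b l).
  have : clear_of s e (b l) by apply: cl; rewrite !inE eqxx orbT.
  have xb : ~~ X (b l) (a s).
    by apply/negP => H; have [_ trX _] := sX; have := trX _ _ _ xl H; rewrite (negbTE asX).
  rewrite /clear_of (negbTE xb) (negbTE bsY) /= => /andP[x1 /orP[H|H]].
    by rewrite /inner x1.
  by have := strict_total_ltNge sY H; rewrite ys'.
have out_0 : ~~ inner (a 0).
  apply/negP => /andP[H _].
  have [_ _ H'] := zigzag_X sX zz (ltnW M1) eM.
  by have := strict_total_ltNge sX H; rewrite H'.
pose c := nth (a l) cs.
have exi : exists i, (i < size cs) && ~~ inner (c i).
  exists (size (b l :: r)); rewrite ltnSn.
  have -> // : c (size (b l :: r)) = a 0.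
  by rewrite -lr -[last _ _]/(last (a l) cs) -nth_last.
case: (ex_minnP exi) => i /andP[isz nin] mini.
have i1 : 1 < i.
  by case: (i) nin => [|[|//]]; rewrite /c /= ?in_a ?in_b.
have in_lt j : j < i -> inner (c j).
  move=> ji; apply/negPn/negP => nj; have := mini j; rewrite nj (ltn_trans ji isz) => /(_ isT).
  by rewrite leqNgt ji.
have := in_lt i.-1 ltac:(clear -i1; lia); set d := c i.-1 => in_d.
(* The first chain point outside the region separates two points inside it, so its vertical or its
   horizontal line passes between them. Clearness leaves few places for such a point. *)
have sepi : sep X Y (c i) d (a l).
  have [_ H] := cr; have [|H' _] := H i; last exact: H'.
  by rewrite i1 -ltnS.
have cli : clear_of s e (c i) by apply: cl; apply: mem_nth.
move: (c i) (d) nin sepi cli in_d => w d' {mini exi in_lt} nin sepi /andP[clX clY] in_d.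
have win j : j < m -> s + j < M by clear -eM; rewrite /e in eM; lia.
have zw : zigzag X Y m (fun k => a (s + k)) (fun k => b (s + k)).
  by apply: (zigzag_sub (g := addn s) zz) => [j k|]; [clear; lia | exact: win].
have dw j k : j < k < m -> Y (a (s + k)) (a (s + j)).
  by move=> jk; apply: down; have := win k; clear -jk; lia.
have cmp j : j <= m -> [/\ ~~ X (a (s + j)) (a s), ~~ X (b e) (b (s + j)),
    ~~ Y (b e) (b (s + j)) & ~~ Y (a (s + j)) (a e)] /\
    (~~ Y (b (s + j)) (b s) /\ ~~ Y (a s) (a (s + j))).
  move=> jm; have [h1 _] := @leX s (s + j) ltac:(clear -eM jm; rewrite /e in eM; lia).
  have [_ h2] := @leX (s + j) e ltac:(clear -eM jm; rewrite /e in eM *; lia).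
  have [h3 h4] := @leY (s + j) e ltac:(clear -eM jm; rewrite /e in eM *; lia).
  by have [h5 h6] := @leY s (s + j) ltac:(clear -eM jm; rewrite /e in eM; lia).
have [_ trX _] := sX; have [_ trY _] := sY.
have abX j : j < m -> X (a (s + j)) (b (s + j)) by move=> jm; have [] := zw j j jm jm.
case HR : (X (b e) w); last first.
  have HL : X w (a s) by rewrite HR orbF in clX.
  have HLb c' : inner c' -> X w c'.
    move=> /andP[H _]; apply: (trX _ _ _ _ H); apply: (trX _ _ _ HL).
    by have [_ _ H'] := zigzag_X sX zz sM' eM; apply: H'; rewrite /e leq_addr.
  case/or3P: clY => [H|/andP[H1 H2]|H].
  (* To the left of the region and below it, [w] cannot separate two of its points. *)
  - exfalso; move: sepi; rewrite /sep /between.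
    have wlow c' : inner c' -> Y w c'.
      move=> /andP[_ /andP[H' _]]; apply: (trY _ _ _ H).
      by apply: (strict_total_le_lt sY _ H'); exact: (cmp m (leqnn m)).2.1.
    rewrite (negbTE (strict_total_ltNge sX (HLb _ in_d))) (negbTE (strict_total_ltNge sX (HLb _ in_a))).
    by rewrite (negbTE (strict_total_ltNge sY (wlow _ in_d))) (negbTE (strict_total_ltNge sY (wlow _ in_a))).
  - apply: (wedge_inner_large_simples sX sY zw dw (w := w)) => j jm.
    have [[h1 h2 h3 h4] _] := cmp j (ltnW jm).
    have xw := strict_total_lt_le sX HL h1.
    split=> //; first exact: (trX _ _ _ xw (abX j jm)).
      exact: (strict_total_le_lt sY h3 H1).
    exact: (strict_total_lt_le sY H2 h4).
  exfalso; move: sepi; rewrite /sep /between.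
  have whigh c' : inner c' -> Y c' w.
    move=> /andP[_ /andP[_ H']]; apply: (trY _ _ _ _ H).
    by apply: (strict_total_lt_le sY H'); exact: (cmp m (leqnn m)).2.2.
  rewrite (negbTE (strict_total_ltNge sX (HLb _ in_d))) (negbTE (strict_total_ltNge sX (HLb _ in_a))).
  by rewrite (negbTE (strict_total_ltNge sY (whigh _ in_d))) (negbTE (strict_total_ltNge sY (whigh _ in_a))) !andbF.
have bw j : j <= m -> X (b (s + j)) w.
  by move=> jm; have [[_ h _ _] _] := cmp j jm; exact: (strict_total_le_lt sX h HR).
case/or3P: clY => [H|H|H].
- have wlow c' : inner c' -> Y w c'.
    move=> /andP[_ /andP[H' _]]; apply: (trY _ _ _ H).
    by apply: (strict_total_le_lt sY _ H'); exact: (cmp m (leqnn m)).2.1.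
  have [q in_q wq] : exists2 q, inner q & X w q.
    move: sepi; rewrite /sep /between.
    rewrite (negbTE (strict_total_ltNge sY (wlow _ in_d))) (negbTE (strict_total_ltNge sY (wlow _ in_a))) orbF.
    by case/orP => /andP[_ wq]; [exists (a l) | exists d'].
  case/and3P: in_q => _ q1 q2.
  have sYi := strict_total_inv sY.
  apply: large_simples_invY.
  (* Reversing the vertical order exchanges the two sides of the wedge. The new second side must
     follow the first one horizontally, so it is shifted by one row; hence [m.+1] clear rows instead
     of [m]. *)
  apply: (wedge_outer_large_simples sX sYi (a := fun k => b (s + k)) (b := fun k => a (s + k.+1)) _ _ (v := w) (q := q)) => //.
  + move=> j k jm km.
    have sj : s + j < M := win j jm; have sk : s + k < M := win k km.
    have sj1 : s + j.+1 < M by clear -eM jm; rewrite /e in eM; lia.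
    have sk1 : s + k.+1 < M by clear -eM km; rewrite /e in eM; lia.
    have [_ h1 _ _] := zz sj sj1; have [_ _ h2] := zigzag_X sX zz sj1 sk.
    have [_ _ _ h3] := zz sk sj1.
    split=> [|jk|jk|//]; first by apply: h1; rewrite addnS.
      by apply: h2; rewrite leq_add2l.
    by apply: down; rewrite sk1 andbT !addnS ltnS ltn_add2l.
  + move=> j k /andP[jk km].
    have [_ _ h _] := zz (win j (ltn_trans jk km)) (win k km).
    by apply: h; rewrite ltn_add2l.
  + move=> j jm; have [[h1 h2 h3 h4] [h5 h6]] := cmp j (ltnW jm).
    have [[h1' h2' h3' h4'] [h5' h6']] := cmp j.+1 jm.
    split.
    * have sj1 : s + j.+1 < M by clear -eM jm; rewrite /e in eM; lia.
      have [h _ _ _] := zz sj1 sj1; exact: (trX _ _ _ h (bw _ jm)).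
    * exact: (strict_total_lt_le sY q2 h4').
    * exact: (strict_total_le_lt sY h3 q1).
    * exact: (strict_total_lt_le sY H h5).
- by case/negP: nin; rewrite /inner HR.
- have whigh c' : inner c' -> Y c' w.
    move=> /andP[_ /andP[_ H']]; apply: (trY _ _ _ _ H).
    by apply: (strict_total_lt_le sY H'); exact: (cmp m (leqnn m)).2.2.
  have [q in_q wq] : exists2 q, inner q & X w q.
    move: sepi; rewrite /sep /between.
    rewrite (negbTE (strict_total_ltNge sY (whigh _ in_d))) (negbTE (strict_total_ltNge sY (whigh _ in_a))) !andbF !orbF.
    by case/orP => /andP[_ wq]; [exists (a l) | exists d'].
  case/and3P: in_q => _ q1 q2.
  apply: (wedge_outer_large_simples sX sY zw dw (v := w) (q := q)) => // j jm.
  have [[h1 h2 h3 h4] [h5 h6]] := cmp j (ltnW jm).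
  split; first exact: (bw _ (ltnW jm)).
  + exact: (strict_total_le_lt sY h3 q1).
  + exact: (strict_total_lt_le sY q2 h4).
  + exact: (strict_total_le_lt sY h6 H).
Qed.

End Wedges.

(** * The structure theorem *)

Lemma monotone_subsequence (T : eqType) (R : rel T) n M (f : nat -> T) :
  strict_total R -> (forall i j, i < j < n -> f i != f j) -> M * M < n ->
  exists g : nat -> nat, [/\ forall i j, i < j <= M -> g i < g j,
    forall i, i <= M -> g i < n &
    (forall i j, i < j <= M -> R (f (g i)) (f (g j))) \/
    (forall i j, i < j <= M -> R (f (g j)) (f (g i)))].
Proof.
move=> sR fn Mn; pose s := [seq f i | i <- iota 0 n].
have us : uniq s.
  rewrite map_inj_in_uniq ?iota_uniq // => i j; rewrite !mem_iota !add0n /= => iN jN e.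
  by case: (ltngtP i j) => // ij; have := fn _ _ (introT andP (conj ij _)); rewrite e eqxx => /(_ _)/negP [].
have szs : M * M < size s by rewrite size_map size_iota.
have pick (t : seq T) : subseq t s -> exists2 idx, sorted ltn idx /\ (forall i, i \in idx -> i < n) &
    t = [seq f i | i <- idx].
  case/subseqP => m _ ->; exists (mask m (iota 0 n)); last by rewrite map_mask.
  split; first exact: (sorted_mask ltn_trans m (iota_ltn_sorted 0 n)).
  by move=> i /mem_mask; rewrite mem_iota.
have x0 : T by case: (s) szs.
have [[t [st ot la]]|[t [st ot la]]] := erdos_szekeres sR us szs;
  have [idx [si ni] et] := pick t st; rewrite et size_map in la; exists (nth 0 idx); split.
- by move=> i j ij; apply: (sorted_ltn_nth ltn_trans 0 si); rewrite ?inE; lia.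
- by move=> i iM; apply: ni; apply: mem_nth; exact: leq_ltn_trans iM la.
- left=> i j ij; have ijs : i < j < size t by rewrite et size_map; lia.
  have := sorted_nth_lt x0 sR ot ijs.
  by rewrite et !(nth_map 0) //; lia.
- by move=> i j ij; apply: (sorted_ltn_nth ltn_trans 0 si); rewrite ?inE; lia.
- by move=> i iM; apply: ni; apply: mem_nth; exact: leq_ltn_trans iM la.
- right=> i j ij; have ijs : i < j < size t by rewrite et size_map; lia.
  have := sorted_nth_lt x0 (strict_total_inv sR) ot ijs.
  by rewrite et !(nth_map 0) //; lia.
Qed.

Lemma chain_sep (T : finType) (X Y X' Y' : rel T) a s :
  (forall z a b, sep X Y z a b = sep X' Y' z a b) -> chain X Y a s -> chain X' Y' a s.
Proof.
move=> e [us cs]; split=> // i ilt; have [H1 H2] := cs i ilt.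
by split=> [|j ji]; rewrite -e ?H1 ?H2.
Qed.

Lemma sep_swap (T : eqType) (X Y : rel T) z a b : sep Y X z a b = sep X Y z a b.
Proof. by rewrite /sep orbC. Qed.

Lemma sep_invY (T : eqType) (X Y : rel T) z a b :
  sep X (fun a b => Y b a) z a b = sep X Y z a b.
Proof. by rewrite /sep (between_inv Y). Qed.

(** Passing to a subsequence of rows keeps the zigzag, so the upper row may be taken rising, which
    is the parallel case, or falling, which is the wedge. *)
Lemma zigzag_large_simples (T : finType) (X Y : rel T) m K M a b :
  strict_total X -> strict_total Y -> simple_orders X Y ->
  (forall c s, chain X Y c s -> size s < K) -> 0 < m -> m.+1 * 3 ^ K <= M ->
  zigzag X Y (M * M).+1 a b -> large_simples m X Y.
Proof.
move=> sX sY simp short m0 MK zz.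
have mM : m <= M.
  apply: leq_trans MK; apply: leq_trans (leqnSn m) _.
  by rewrite leq_pmulr // expn_gt0.
have aneq i j : i < j < (M * M).+1 -> a i != a j.
  move=> /andP[ij jM]; apply: (strict_total_lt_neq sX).
  by have [H _ _] := zigzag_X sX zz (ltn_trans ij jM) jM; exact: H.
have [g [g1 g2 g3]] := monotone_subsequence sY aneq (ltnSn _).
have zg k : k <= M -> zigzag X Y k (a \o g) (b \o g).
  move=> kM; apply: (zigzag_sub zz) => [i j ij|i ik]; first by apply: g1; lia.
  by apply: g2; lia.
case: g3 => g3.
  by apply: (parallel_large_simples sX sY (zg m mM)) => i j ij; apply: g3; lia.
by apply: (wedge_large_simples sX sY (zg M (leqnn M)) _ simp short m0 MK) => i j ij; apply: g3; lia.
Qed.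

(** Each cut lies between [u t] and [u t.+1], so cuts and points of [u] alternate. The cut at [t] is
    paired with the point at the next selected index, whence [L < size ts]. *)
Lemma far_above_zigzag (T : finType) (X Y : rel T) n L u z ts :
  strict_total X -> strict_total Y -> increasing X Y n u -> sorted ltn ts ->
  (forall t, t \in ts -> t < n) ->
  (forall t, t \in ts -> [&& X (u t) (z t), X (z t) (u t.+1) & Y (u n) (z t)]) ->
  L < size ts ->
  zigzag X Y L (fun i => z (nth 0 ts i)) (fun i => u (nth 0 ts i.+1)).
Proof.
move=> sX sY inc st tn H Ls i j iL jL.
have [_ trX _] := sX; have [_ trY _] := sY.
have tlt k l : k < l -> l <= L -> nth 0 ts k < nth 0 ts l.
  by move=> kl lL; apply: (sorted_ltn_nth ltn_trans 0 st); rewrite ?inE; lia.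
have tin k : k <= L -> nth 0 ts k \in ts by move=> kL; apply: mem_nth; exact: leq_ltn_trans kL Ls.
have tnn k : k <= L -> nth 0 ts k < n by move=> kL; exact: tn (tin k kL).
have [/and3P[x1 x2 y1]] := H _ (tin i (ltnW iL)).
have [/and3P[x3 x4 y2]] := H _ (tin j (ltnW jL)).
have leu k l : k <= l <= n -> X (u k) (u l) \/ k = l.
  move=> kl; case: (eqVneq k l) => [|ne]; first by right.
  by left; apply: (inc _ _ _).1; lia.
split=> [|ij|ij|].
- have := tlt i i.+1 (ltnSn i) iL => H1.
  have [H2|<-//] := leu (nth 0 ts i).+1 (nth 0 ts i.+1) ltac:(have := tnn i.+1 iL; lia).
  exact: trX x2 H2.
- have H1 : nth 0 ts i.+1 <= nth 0 ts j.
    by move: ij; rewrite leq_eqVlt => /predU1P[->//|ij]; apply/ltnW/tlt => //; lia.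
  have [H2|->//] := leu (nth 0 ts i.+1) (nth 0 ts j) ltac:(have := tnn j (ltnW jL); lia).
  exact: trX H2 x3.
- by apply: (inc _ _ _).2; rewrite tlt //= ltnW // tnn.
- by apply: trY y2; apply: (inc _ _ _).2; rewrite tnn ?leqnn.
Qed.

(** Rotating by 180 degrees keeps [u] increasing when it is read backwards, and puts the cuts above
    it. *)
Lemma far_below_zigzag (T : finType) (X Y : rel T) n L u z ts :
  strict_total X -> strict_total Y -> increasing X Y n u -> sorted ltn ts ->
  (forall t, t \in ts -> t < n) ->
  (forall t, t \in ts -> [&& X (u t) (z t), X (z t) (u t.+1) & Y (z t) (u 0)]) ->
  L < size ts ->
  zigzag (fun a b => X b a) (fun a b => Y b a) L
    (fun i => z (nth 0 ts (L - i))) (fun i => u (nth 0 ts (L - i))).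
Proof.
move=> sX sY inc st tn H Ls i j iL jL.
have [_ trX _] := sX; have [_ trY _] := sY.
have tlt k l : k < l -> l <= L -> nth 0 ts k < nth 0 ts l.
  by move=> kl lL; apply: (sorted_ltn_nth ltn_trans 0 st); rewrite ?inE; lia.
have tin k : k <= L -> nth 0 ts k \in ts by move=> kL; apply: mem_nth; exact: leq_ltn_trans kL Ls.
have tnn k : k <= L -> nth 0 ts k < n by move=> kL; exact: tn (tin k kL).
have [/and3P[x1 x2 y1]] := H _ (tin (L - i) (leq_subr _ _)).
have [/and3P[x3 x4 y2]] := H _ (tin (L - j) (leq_subr _ _)).
have leu k l : k <= l <= n -> X (u k) (u l) \/ k = l.
  move=> kl; case: (eqVneq k l) => [|ne]; first by right.
  by left; apply: (inc _ _ _).1; lia.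
split=> [//|ij|ij|].
- have H1 := tlt (L - j) (L - i) ltac:(lia) (leq_subr _ _).
  have [H2|<-//] := leu (nth 0 ts (L - j)).+1 (nth 0 ts (L - i)) ltac:(have := tnn (L - i) (leq_subr _ _); lia).
  exact: trX x4 H2.
- by apply: (inc _ _ _).2; rewrite tlt ?leq_subr ?(ltnW (tnn _ _)) ?leq_subr //; lia.
- have [e|e] := posnP (nth 0 ts (L - i)); first by rewrite e.
  by apply: (trY _ _ _ y2); apply: (inc _ _ _).2; rewrite e ltnW // tnn // leq_subr.
Qed.

Lemma pigeonhole4 (n : nat) (P1 P2 P3 P4 : pred nat) L :
  (forall t, t < n -> [|| P1 t, P2 t, P3 t | P4 t]) -> 4 * L < n ->
  [\/ L < size (filter P1 (iota 0 n)), L < size (filter P2 (iota 0 n)),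
      L < size (filter P3 (iota 0 n)) | L < size (filter P4 (iota 0 n))].
Proof.
move=> H Ln; have : size (iota 0 n) <= size (filter P1 (iota 0 n)) +
  size (filter P2 (iota 0 n)) + size (filter P3 (iota 0 n)) + size (filter P4 (iota 0 n)).
  have {}H t : t \in iota 0 n -> [|| P1 t, P2 t, P3 t | P4 t].
    by rewrite mem_iota => /H.
  elim: (iota 0 n) H => //= t s IH H.
  have {}IH := IH (fun t' ts => H t' (mem_behead (s := t :: s) ts)).
  by have := H t (mem_head _ _); do 4 (case: ifP => _ /=); lia.
rewrite size_iota => Hs.
case: (ltnP L (size (filter P1 (iota 0 n)))); first by constructor 1.
case: (ltnP L (size (filter P2 (iota 0 n)))); first by constructor 2.
case: (ltnP L (size (filter P3 (iota 0 n)))); first by constructor 3.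
case: (ltnP L (size (filter P4 (iota 0 n)))); first by constructor 4.
by lia.
Qed.

Definition pin_length (m : nat) : nat :=
  pump_states ((bool * bool) * (bool * bool))%type m + 2.
Definition wedge_rows (m : nat) : nat := m.+1 * 3 ^ pin_length m.
(** A cut passes in one of two directions and lies on one of two sides; the factor 4 lets one kind
    occur often enough for a zigzag. *)
Definition cut_count (m : nat) : nat := (4 * (wedge_rows m * wedge_rows m).+1).+1.
(** The successor leaves one point of the sequence beyond the window. *)
Definition monotone_length (m : nat) : nat := (cut_count m ^ pin_length m).+1.
Definition simple_bound (m : nat) : nat := (monotone_length m * monotone_length m).+1.

Section Assembly.

Context (m : nat).
Hypothesis m0 : 0 < m.

Let short (T : finType) (X Y : rel T) := forall c s, chain X Y c s -> size s < pin_length m.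

Let short_swap (T : finType) (X Y : rel T) : short X Y -> short Y X.
Proof. by move=> sh c s cs; apply: (sh c); apply: chain_sep cs => *; exact: sep_swap. Qed.

Let short_invY (T : finType) (X Y : rel T) : short X Y -> short X (fun a b => Y b a).
Proof. by move=> sh c s cs; apply: (sh c); apply: chain_sep cs => *; exact: sep_invY. Qed.

Let zz_large (T : finType) (X Y : rel T) a b : strict_total X -> strict_total Y ->
  simple_orders X Y -> short X Y ->
  zigzag X Y (wedge_rows m * wedge_rows m).+1 a b -> large_simples m X Y.
Proof. by move=> sX sY simp sh; apply: zigzag_large_simples sh m0 _ => //. Qed.

Let zz_inv_large (T : finType) (X Y : rel T) a b : strict_total X -> strict_total Y ->
  simple_orders X Y -> short X Y ->
  zigzag (fun a b => X b a) (fun a b => Y b a) (wedge_rows m * wedge_rows m).+1 a b ->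
  large_simples m X Y.
Proof.
move=> sX sY simp sh zz.
apply/large_simples_invY/large_simples_swap/large_simples_invY/large_simples_swap.
apply: (zz_large (strict_total_inv sX) (strict_total_inv sY) _ _ zz).
  exact/simple_orders_swap/simple_orders_invY/simple_orders_swap/simple_orders_invY.
exact/short_swap/short_invY/short_swap/short_invY.
Qed.

Lemma far_cuts_large_simples (T : finType) (X Y : rel T) :
  strict_total X -> strict_total Y -> simple_orders X Y -> short X Y ->
  far_cuts X Y (cut_count m) -> large_simples m X Y.
Proof.
move=> sX sY simp sh [u [z [inc H]]]; set n := cut_count m in inc H.
have inc' : increasing Y X n u by move=> i j ij; have [] := inc i j ij.
pose P1 t := [&& X (u t) (z t), X (z t) (u t.+1) & Y (u n) (z t)].
pose P2 t := [&& X (u t) (z t), X (z t) (u t.+1) & Y (z t) (u 0)].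
pose P3 t := [&& Y (u t) (z t), Y (z t) (u t.+1) & X (u n) (z t)].
pose P4 t := [&& Y (u t) (z t), Y (z t) (u t.+1) & X (z t) (u 0)].
have HP t : t < n -> [|| P1 t, P2 t, P3 t | P4 t].
  move=> tn; rewrite /P1 /P2 /P3 /P4; case/orP: (H t tn) => /and3P[-> -> /orP[]->];
  by rewrite ?orbT.
have srt P : sorted ltn (filter P (iota 0 n)).
  exact: (sorted_filter ltn_trans _ (iota_ltn_sorted 0 n)).
have bnd (P : pred nat) t : t \in filter P (iota 0 n) -> t < n.
  by rewrite mem_filter mem_iota => /andP[_].
have PP (P : pred nat) t : t \in filter P (iota 0 n) -> P t by rewrite mem_filter => /andP[].
have simp' := simple_orders_swap simp; have sh' := short_swap sh.
case: (pigeonhole4 HP (ltnSn _)) => Hs.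
- exact: (zz_large sX sY simp sh (far_above_zigzag sX sY inc (srt _) (@bnd _) (@PP P1) Hs)).
- exact: (zz_inv_large sX sY simp sh (far_below_zigzag sX sY inc (srt _) (@bnd _) (@PP P2) Hs)).
- apply: large_simples_swap.
  exact: (zz_large sY sX simp' sh' (far_above_zigzag sY sX inc' (srt _) (@bnd _) (@PP P3) Hs)).
- apply: large_simples_swap.
  exact: (zz_inv_large sY sX simp' sh' (far_below_zigzag sY sX inc' (srt _) (@bnd _) (@PP P4) Hs)).
Qed.

(** Without far cuts, all short chains from some consecutive pair stay in the box of the window. By
    simplicity a chain from this pair ends at the last point of the sequence, outside the box. *)
Lemma increasing_large_simples (T : finType) (X Y : rel T) u :
  strict_total X -> strict_total Y -> simple_orders X Y -> short X Y ->
  increasing X Y (monotone_length m) u -> large_simples m X Y.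
Proof.
move=> sX sY simp sh inc.
have [|//|[s sa Hs]] := window_chains sX sY (i := pin_length m) (a := 0) inc (ltn0Sn _ : 0 < cut_count m).
  exact: leqnSn.
  exact: far_cuts_large_simples.
set N := monotone_length m in inc.
have sN : s.+1 < N by move: sa => /andP[_]; rewrite add0n.
have ab : u s != u s.+1.
  by apply: (strict_total_lt_neq sX); apply: (inc _ _ _).1; rewrite ltnSn ltnW.
have vb : u N != u s.
  by rewrite eq_sym; apply: (strict_total_lt_neq sX); apply: (inc _ _ _).1; rewrite leqnn andbT ltnW.
have [r [cr lr]] := simple_chain sX sY simp ab vb.
have szr : size r <= pin_length m by have /= := sh _ _ cr; do 2 move/ltnW.
have /allP/(_ (u N)) := Hs r cr szr.
rewrite -lr inE mem_last orbT => /(_ isT); rewrite lr => /and4P[_ + _ _].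
by rewrite (inc _ _ _).1 // add0n leqnn andbT.
Qed.

Theorem simple_large_simples (T : finType) (X Y : rel T) : 2 < m ->
  strict_total X -> strict_total Y -> simple_orders X Y -> simple_bound m <= #|T| ->
  large_simples m X Y.
Proof.
move=> m2 sX sY simp sb.
case: (classic (short X Y)) => [sh|nsh].
  have [u [inc|inc]] := monotone_points sX sY sb.
    exact: increasing_large_simples inc.
  apply: large_simples_invY; apply: increasing_large_simples inc => //.
  - exact: strict_total_inv.
  - exact: simple_orders_invY.
  - exact: short_invY.
have [c nsh'] := not_all_ex_not _ _ nsh; have [s {}nsh] := not_all_ex_not _ _ nsh'.
have [cs /negP] := imply_to_and _ _ nsh; rewrite -leqNgt => long.
exact: (long_chain_large_simples sX sY m2 cs).
Qed.

End Assembly.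

(** * Permutations as pairs of orders *)

Lemma subseq_iota n (idx : seq nat) :
  sorted ltn idx -> (forall i, i \in idx -> i < n) -> subseq idx (iota 0 n).
Proof.
move=> si ni; suff -> : idx = filter (mem idx) (iota 0 n) by exact: filter_subseq.
apply: (irr_sorted_eq ltn_trans ltnn) => //.
  exact: (sorted_filter ltn_trans _ (iota_ltn_sorted 0 n)).
move=> i; rewrite mem_filter mem_iota /=.
by case: (boolP (i \in idx)) => //= /ni ->.
Qed.

Lemma containsP (pi sigma : seq nat) : contains pi sigma <->
  exists idx : seq nat, [/\ sorted ltn idx, (forall i, i \in idx -> i < size pi) &
    order_iso [seq nth 0 pi i | i <- idx] sigma].
Proof.
have pE : pi = [seq nth 0 pi i | i <- iota 0 (size pi)] by rewrite -[LHS](mkseq_nth 0).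
split=> [[m [sm iso]]|[idx [si ni iso]]].
  exists (mask m (iota 0 (size pi))); split.
  - exact: (sorted_mask ltn_trans m (iota_ltn_sorted 0 _)).
  - by move=> i /mem_mask; rewrite mem_iota.
  by rewrite map_mask -pE.
have [m sm e] := subseqP (subseq_iota si ni).
exists m; split; first by rewrite sm size_iota.
by rewrite [X in mask _ X]pE -map_mask -e.
Qed.

Definition pos_rel (pi : seq nat) : rel 'I_(size pi) := fun i j => i < j.
Definition val_rel (pi : seq nat) : rel 'I_(size pi) :=
  fun i j => nth 0 pi i < nth 0 pi j.

Lemma is_perm_uniq pi : is_perm pi -> uniq pi.
Proof. by move/perm_uniq ->; exact: iota_uniq. Qed.

Lemma pos_rel_strict_total pi : strict_total (@pos_rel pi).
Proof. exact: (coord_rel_strict_total (x := val) val_inj). Qed.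

Lemma val_rel_strict_total pi : is_perm pi -> strict_total (@val_rel pi).
Proof.
move=> pp; apply: (coord_rel_strict_total (x := fun i : 'I_(size pi) => nth 0 pi i)).
by move=> i j /eqP; rewrite nth_uniq ?is_perm_uniq // => /eqP/val_inj.
Qed.

(** Closedness in the positions fills the range from [lo] to [hi], and closedness in the values
    fills the range from [a] to [b]; so a closed set is an interval. *)
Lemma simple_perm_orders pi : simple_perm pi -> simple_orders (@pos_rel pi) (@val_rel pi).
Proof.
move=> [pp simp] M cM; case: (leqP #|M| 1) => [|M1]; first by left.
right; have up := is_perm_uniq pp.
have cx (i j k : 'I_(size pi)) : i \in M -> j \in M -> i < k < j -> k \in M.
  by move=> iM jM ikj; apply: (cM i j) => //; rewrite /sep /between /pos_rel ikj.
have cy (i j k : 'I_(size pi)) : i \in M -> j \in M ->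
    nth 0 pi i < nth 0 pi k < nth 0 pi j -> k \in M.
  by move=> iM jM ikj; apply: (cM i j) => //; rewrite /sep /between /val_rel ikj orbT.
case/card_gt1P: M1 => [u0 [v0 [u0M v0M uv0]]].
case: (arg_minnP (fun i : 'I_(size pi) => i : nat) u0M) => lo loM minlo.
case: (arg_maxnP (fun i : 'I_(size pi) => i : nat) u0M) => hi hiM maxhi.
case: (arg_minnP (fun i : 'I_(size pi) => nth 0 pi i) u0M) => bo boM minbo.
case: (arg_maxnP (fun i : 'I_(size pi) => nth 0 pi i) u0M) => to toM maxto.
pose a := nth 0 pi bo; pose b := nth 0 pi to; pose k := hi.+1 - lo.
have lohi : lo < hi.
  have := minlo _ u0M; have := minlo _ v0M; have := maxhi _ u0M; have := maxhi _ v0M.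
  move: uv0; rewrite -val_eqE /=; move: (val u0) (val v0) => x y; rewrite /=; lia.
have memM (i : 'I_(size pi)) : (i \in M) = (lo <= i <= hi).
  apply/idP/andP => [iM|[li ih]]; first by split; [exact: minlo | exact: maxhi].
  case: (eqVneq lo i) => [<-//|nl]; case: (eqVneq i hi) => [->//|nh].
  by apply: (cx _ _ _ loM hiM); rewrite !ltn_neqAle li ih -!val_eqE /= in nl nh *; rewrite nl nh.
have lok : lo + k <= size pi by rewrite /k; have := ltn_ord hi; lia.
have szk : size (take k (drop lo pi)) = k by rewrite size_takel // size_drop; lia.
have seg x : (x \in take k (drop lo pi)) = (a <= x < b.+1).
  apply/(nthP 0)/idP => [[j]|xab].
    rewrite szk => jk; rewrite nth_take // nth_drop => <-.
    have jn : lo + j < size pi by lia.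
    have jM : Ordinal jn \in M by rewrite memM /= ; rewrite /k in jk; lia.
    by have := minbo _ jM; have := maxto _ jM; rewrite /a /b /= ltnS => -> ->.
  have bn (i : 'I_(size pi)) : nth 0 pi i \in iota 1 (size pi) by rewrite -(perm_mem pp) mem_nth.
  have : x \in pi.
    rewrite (perm_mem pp) mem_iota; have := bn bo; have := bn to; rewrite !mem_iota.
    by rewrite -/a -/b; lia.
  case/(nthP 0) => i isz e; have iM : Ordinal isz \in M.
    case: (eqVneq (Ordinal isz) bo) => [->//|nb]; case: (eqVneq (Ordinal isz) to) => [->//|nt].
    have nval (j : 'I_(size pi)) : Ordinal isz != j -> x != nth 0 pi j.
      by move=> ne; rewrite -e nth_uniq.
    by apply: (cy _ _ _ boM toM); rewrite /= e; move: xab (nval _ nb) (nval _ nt); rewrite -/a -/b; clear; lia.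
  exists (i - lo); rewrite ?szk; move: iM; rewrite memM /= => ilh; first by rewrite /k; lia.
  by rewrite nth_take ?nth_drop ?subnKC ?e //; [case/andP: ilh | rewrite /k; lia].
have pe : perm_eq (take k (drop lo pi)) (iota a (b.+1 - a)).
  apply: uniq_perm; rewrite ?take_uniq ?drop_uniq ?iota_uniq // => x.
  by rewrite seg mem_iota; have := minbo _ toM; rewrite -/a -/b; lia.
have kab : k = b.+1 - a by rewrite -szk (perm_size pe) size_iota.
have /(simp lo k lok) : is_interval pi lo k by exists a; rewrite {2}kab.
have k1 : 1 < k by rewrite /k; lia.
case=> [k0|[k0|kn]]; try by rewrite k0 in k1.
by apply/setP => i; rewrite inE memM; have := ltn_ord i; have := ltn_ord hi; rewrite /k in kn lok; lia.
Qed.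

(** * The permutation of two orders on a finite set *)

Section PermOfOrders.

Context (T : finType) (X Y : rel T).
Hypotheses (sX : strict_total X) (sY : strict_total Y).

Definition rank (t : T) : nat := #|[set s | Y s t]|.

Lemma rank_lt s t : (rank s < rank t) = Y s t.
Proof.
have [irY trY _] := sY.
have lt u v : Y u v -> rank u < rank v.
  move=> uv; apply: proper_card; apply/properP; split.
    by apply/subsetP => w; rewrite !inE => wu; exact: trY wu uv.
  by exists u; rewrite !inE ?irY.
case: (eqVneq s t) => [->|st]; first by rewrite ltnn irY.
case Yst : (Y s t); first exact: lt.
have Yts : Y t s by rewrite (strict_total_asym sY st) Yst.
by apply/negbTE; rewrite -leqNgt ltnW // lt.
Qed.

Lemma rank_inj : injective rank.
Proof.
move=> s t e; apply/eqP/negPn/negP => st.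
have [_ _ tot] := sY; have := tot s t st.
by rewrite -!rank_lt e ltnn.
Qed.

Lemma rank_bound t : rank t < #|T|.
Proof.
rewrite -cardsT; apply: proper_card; apply/properP; split; first exact: subsetT.
by exists t; rewrite !inE //; have [-> _ _] := sY.
Qed.

Definition perm_of (e : seq T) : seq nat := [seq (rank t).+1 | t <- e].

Context (e : seq T).
Hypothesis pe : perm_eq e (enum T).

Let ue : uniq e.
Proof. by rewrite (perm_uniq pe) enum_uniq. Qed.

Let ine t : t \in e.
Proof. by rewrite (perm_mem pe) mem_enum. Qed.

Lemma size_perm_of : size (perm_of e) = #|T|.
Proof. by rewrite size_map (perm_size pe) -cardE. Qed.

Lemma perm_of_is_perm : is_perm (perm_of e).
Proof.
have up : uniq (perm_of e) by rewrite map_inj_uniq // => s t [/rank_inj].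
rewrite /is_perm; apply: uniq_perm; rewrite ?iota_uniq //.
have sub : {subset perm_of e <= iota 1 (size (perm_of e))}.
  by move=> x /mapP[t _ ->]; rewrite mem_iota size_perm_of; have := rank_bound t; lia.
by have [|_ ] := uniq_min_size up sub; first rewrite size_iota.
Qed.

Hypothesis se : sorted X e.

Lemma perm_of_simple : simple_orders X Y -> simple_perm (perm_of e).
Proof.
move=> simp; split; first exact: perm_of_is_perm.
rewrite size_perm_of => i k ik [a pa].
have [T0|/card_gt0P[x0 _]] := posnP #|T|; first by left; lia.
have sze : size e = #|T| by rewrite (perm_size pe) -cardE.
have seg : take k (drop i (perm_of e)) = perm_of (take k (drop i e)).
  by rewrite /perm_of map_take map_drop.
pose M := [set t in take k (drop i e)].
have szM : #|M| = k.
  rewrite cardsE; have /card_uniqP -> : uniq (take k (drop i e)) by rewrite take_uniq ?drop_uniq.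
  by rewrite size_takel // size_drop sze; lia.
have MP t : reflect (i <= index t e < i + k) (t \in M).
  rewrite inE; apply: (iffP (nthP x0)) => [[j]|ie].
    rewrite size_takel ?size_drop ?sze; last by lia.
    by move=> jk; rewrite nth_take // nth_drop => <-; rewrite index_uniq ?sze //; lia.
  exists (index t e - i); first by rewrite size_takel ?size_drop ?sze; lia.
  by rewrite nth_take ?nth_drop ?subnKC ?nth_index //; lia.
have idxX s t : X s t -> index s e < index t e.
  move=> st; rewrite ltnNge leq_eqVlt; apply/negP => /predU1P[ei|lti].
    have est : s = t by rewrite -(nth_index x0 (ine s)) -ei nth_index.
    by have [irX _ _] := sX; move: st; rewrite est irX.
  have : X (nth x0 e (index t e)) (nth x0 e (index s e)).
    by apply: (sorted_nth_lt x0 sX se); rewrite lti index_mem ine.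
  by rewrite !nth_index //; apply/negP; exact: (strict_total_ltNge sX).
have MR t : t \in M = ((rank t).+1 \in iota a k).
  rewrite -(perm_mem pa) seg inE; apply/idP/mapP => [tM|[s sM [/rank_inj ->]]//].
  by exists t.
have := simp M; case=> [s t z sM tM|M1|MT].
- case/orP => [|sz].
    move/MP: sM => sM; move/MP: tM => tM.
    by case/orP => /andP[/idxX h1 /idxX h2]; apply/MP; lia.
  rewrite MR in sM; rewrite MR in tM; rewrite MR; move: sM tM sz; rewrite !mem_iota /between -!rank_lt; lia.
- by move: M1; rewrite szM; case: (k) => [|[|]] //; [left | right; left].
- by right; right; rewrite -szM MT cardsT.
Qed.

Lemma perm_of_contains (m : nat) (pi beta : seq nat) : is_perm pi -> size beta <= m ->
  small_embed m X Y (@pos_rel pi) (@val_rel pi) ->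
  contains (perm_of e) beta -> contains pi beta.
Proof.
move=> pp bm emb /containsP[idx [si ni [sz iso]]]; rewrite size_map in sz iso.
(* The empty occurrence is treated apart; a nonempty one provides the default element [x0]. *)
have [idx0|idxn] := eqVneq idx [::].
  apply/containsP; exists [::]; split=> //; split; first by rewrite -sz idx0.
  by move=> i j; rewrite ltn0.
have x0 : T.
  case: (idx) idxn ni => // i0 ? _ /(_ i0 (mem_head _ _)).
  by rewrite size_map; case: (e).
pose pt i := nth x0 e i; pose S := [set t in [seq pt i | i <- idx]].
have [|f Hf] := emb S.
  by apply: leq_trans bm; rewrite -sz -(size_map pt) cardsE card_size.
have inS i : i \in idx -> pt i \in S by move=> ii; rewrite inE map_f.
have szi : forall i, i \in idx -> i < size e by move=> i /ni; rewrite size_map.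
have mono i j : i < j < size idx -> f (pt (nth 0 idx i)) < f (pt (nth 0 idx j)).
  move=> /andP[ij jl]; have il := ltn_trans ij jl.
  have ii : nth 0 idx i \in idx by exact: mem_nth.
  have jj : nth 0 idx j \in idx by exact: mem_nth.
  have [H _] := Hf _ _ (inS _ ii) (inS _ jj).
  rewrite -[_ < _]/(pos_rel (f _) (f _)) -H.
  apply: (sorted_nth_lt x0 sX se); rewrite szi // andbT.
  exact: (sorted_ltn_nth ltn_trans 0 si).
apply/containsP; exists [seq val (f (pt i)) | i <- idx]; split.
- rewrite sorted_pairwise; last exact: ltn_trans.
  apply/(pairwiseP 0) => i j; rewrite !inE size_map => il jl ij.
  by rewrite !(nth_map 0) //; apply: mono; rewrite ij.
- by move=> i /mapP[j _ ->]; exact: ltn_ord.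
- split; first by rewrite !size_map.
  move=> i j; rewrite !size_map => il jl.
  rewrite -iso // !(nth_map 0) ?size_map //.
  have ii : nth 0 idx i \in idx by apply: mem_nth.
  have jj : nth 0 idx j \in idx by apply: mem_nth.
  have [_ H] := Hf _ _ (inS _ ii) (inS _ jj); rewrite /val_rel in H; rewrite -H.
  by rewrite !(nth_map x0) ?szi // ltnS rank_lt.
Qed.

End PermOfOrders.

Lemma large_simple_perms B pi m n : inAv B pi -> simple_perm pi ->
  (forall beta, beta \in B -> size beta <= m) -> 2 < m -> simple_bound m <= size pi ->
  exists pi', [/\ simple_perm pi', inAv B pi' & n <= size pi' <= n + 10].
Proof.
move=> [pp av] simp Bm m2 sb.
have m0 : 0 < m by lia.
have large := simple_large_simples m0 m2 (pos_rel_strict_total pi) (val_rel_strict_total pp)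
  (simple_perm_orders simp).
rewrite card_ord in large; have [T [X [Y [sX sY so cn emb]]]] := large sb n.
have [e [se pe]] := sorted_enum sX.
exists (perm_of Y e); split; last by rewrite (size_perm_of Y pe).
  exact: (perm_of_simple sX sY pe se so).
split; first exact: (perm_of_is_perm sY pe).
move=> beta bB cb; apply: (av beta bB).
exact: (perm_of_contains sX sY se pp (Bm _ bB) emb cb).
Qed.

(** * Recursive functions on codes of lists *)

Lemma sum_delta n k (F : nat -> nat) : k < n -> \sum_(i < n) (i == k :> nat) * F i = F k.
Proof.
move=> kn; rewrite (bigD1 (Ordinal kn)) //= eqxx mul1n big1 ?addn0 // => i.
by rewrite -val_eqE /= => /negbTE ->.
Qed.

Lemma code_cons_inj n s i t :
  (CodeSeq.code (n :: s) == 2 ^ i * t.*2.+1) = (i == n) && (t == CodeSeq.code s).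
Proof.
rewrite -{1}[t]CodeSeq.decodeK -[2 ^ i * _]/(CodeSeq.code (i :: CodeSeq.decode t)).
rewrite (can_eq CodeSeq.codeK) eqseq_cons eq_sym; congr (_ && _).
by rewrite eq_sym -(can_eq CodeSeq.codeK) CodeSeq.decodeK.
Qed.

(* The code of [n :: s] is [2 ^ n * (code s).*2.+1], so head and tail are found
   by a bounded search for this decomposition. *)
Definition code_head (c : nat) : nat :=
  \sum_(i < c) \sum_(t < c) (c == 2 ^ i * t.*2.+1) * i.
Definition code_tail (c : nat) : nat :=
  \sum_(i < c) \sum_(t < c) (c == 2 ^ i * t.*2.+1) * t.

Lemma code_tail_lt n s : CodeSeq.code s < CodeSeq.code (n :: s).
Proof.
rewrite /= -[X in X < _]mul1n; apply: (@leq_trans (1 * (CodeSeq.code s).*2.+1)).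
  by rewrite !mul1n; lia.
by rewrite leq_mul2r expn_gt0 orbT.
Qed.

Lemma code_head_lt n s : n < CodeSeq.code (n :: s).
Proof. by have /= /andP[] := CodeSeq.ltn_code (n :: s). Qed.

(** Only one pair decomposes the code, so the double sum has a single nonzero coefficient. *)
Lemma code_pair_sum n s (F : nat -> nat -> nat) (c := CodeSeq.code (n :: s)) :
  \sum_(i < c) \sum_(t < c) (c == 2 ^ i * t.*2.+1) * F i t = F n (CodeSeq.code s).
Proof.
rewrite -(sum_delta (fun i => F i (CodeSeq.code s)) (code_head_lt n s)).
apply: eq_bigr => i _; rewrite -(sum_delta (F i) (code_tail_lt n s)) big_distrr /=.
apply: eq_bigr => t _; rewrite -/(CodeSeq.code (n :: s)) /c code_cons_inj.
by case: (_ == n); case: (_ == CodeSeq.code s); rewrite ?mul1n ?mul0n ?muln0.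
Qed.

Lemma code_headE s : code_head (CodeSeq.code s) = head 0 s.
Proof.
case: s => [|n s]; first by rewrite /code_head big_ord0.
exact: (code_pair_sum n s (fun i _ => i)).
Qed.

Lemma code_tailE s : code_tail (CodeSeq.code s) = CodeSeq.code (behead s).
Proof.
case: s => [|n s]; first by rewrite /code_tail big_ord0.
exact: (code_pair_sum n s (fun _ t => t)).
Qed.

Lemma iter_code_tail k s : iter k code_tail (CodeSeq.code s) = CodeSeq.code (drop k s).
Proof.
elim: k s => [|k IH] s; first by rewrite drop0.
by rewrite iterSr code_tailE IH -drop1 drop_drop addn1.
Qed.

Lemma leq_size_code s : size s <= CodeSeq.code s.
Proof. by elim: s => // n s IH; exact: leq_ltn_trans IH (code_tail_lt n s). Qed.

(** An entry at most [D] costs at most [D.+1] bits. This bounds every search for a list. *)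
Lemma code_bound s D : all (fun i => i <= D) s -> CodeSeq.code s < 2 ^ (D.+1 * size s).
Proof.
elim: s => [|n s IH] /=; first by rewrite muln0.
case/andP=> nD /IH lt; rewrite [D.+1 * _]mulnS addSnnS expnD.
apply: (@leq_ltn_trans (2 ^ D * (CodeSeq.code s).*2.+1)).
  by rewrite leq_mul2r leq_exp2l ?nD ?orbT.
by rewrite ltn_pmul2l ?expn_gt0 // expnS; move: (2 ^ _) lt => p; lia.
Qed.

Definition elt (c i : nat) : nat := nth 0 (CodeSeq.decode c) i.
Definition len (c : nat) : nat := size (CodeSeq.decode c).

Lemma eltE c i : elt c i = code_head (iter i code_tail c).
Proof.
by rewrite -{2}[c]CodeSeq.decodeK iter_code_tail code_headE -nth0 nth_drop addn0.
Qed.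

Lemma lenE c : len c = \sum_(i < c) (iter i code_tail c != 0).
Proof.
have H (i : nat) : (iter i code_tail c != 0) = (i < len c).
  rewrite -{1}[c]CodeSeq.decodeK iter_code_tail -subn_gt0 /len -size_drop.
  case: (drop _ _) => [|n s] //; rewrite -lt0n.
  by rewrite (leq_ltn_trans (leq0n _) (code_tail_lt n s)).
under eq_bigr do rewrite H.
have lc : len c <= c by have := leq_size_code (CodeSeq.decode c); rewrite CodeSeq.decodeK.
suff sum n k : \sum_(i < n) (i < k) = minn k n by rewrite sum; apply/esym/minn_idPl.
by elim: n => [|n IH]; rewrite ?big_ord0 ?minn0 // big_ord_recr /= IH; lia.
Qed.

(** Each bounded quantifier puts its variable in front of the list, so [behead] is weakening, and a
    variable appears as an entry of an iterated [behead]. *)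
Lemma computable_beheads k n F :
  computable n F -> computable (k + n) (fun v => F (iter k behead v)).
Proof.
move=> cF; elim: k => // k IH; apply: computable_ext (computable_behead IH) => v _.
by rewrite iterSr.
Qed.

Lemma computable_var n k i :
  k + i < n -> computable n (fun v => nth 0 (iter k behead v) i).
Proof.
move=> kin; apply: computable_ext (computable_nth kin) => v _; rewrite addnC.
elim: k i {kin} => [|k IH] i; first by rewrite addn0.
by rewrite addnS -addSn IH /= nth_behead.
Qed.

Ltac computable_atom :=
  match goal with
  | |- computable _ _ => first
    [ by apply: (@computable_var _ 0 0) | by apply: (@computable_var _ 1 0)
    | by apply: (@computable_var _ 2 0) | by apply: (@computable_var _ 3 0)
    | by apply: (@computable_var _ 4 0) | exact: computable_const ]
  end || match goal with
  | H : computable _ _ |- computable _ _ => first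
    [ exact: H | exact: (computable_beheads 1 H) | exact: (computable_beheads 2 H)
    | exact: (computable_beheads 3 H) | exact: (computable_beheads 4 H) ]
  end.

Ltac computable_step := first
  [ computable_atom
  | apply: decidable_and | apply: decidable_or | apply: decidable_not
  | apply: decidable_imp | apply: decidable_eqb | apply: decidable_le
  | apply: decidable_eq
  | apply: computable_add | apply: computable_mul | apply: computable_exp
  | apply: computable_sub | apply: computable_succ ].

Lemma computable_double n F : computable n F -> computable n (fun v => (F v).*2).
Proof.
move=> cF; apply: computable_ext (computable_add cF cF) => v _; exact: addnn.
Qed.

Lemma computable_code_head : computable1 code_head.
Proof.
apply: (@computable_sum _ _ (fun i v =>
  \sum_(t < nth 0 v 0) (nth 0 v 0 == 2 ^ i * t.*2.+1) * i)); first by repeat computable_step.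
apply: (@computable_sum _ _ (fun t v =>
  (nth 0 (behead v) 0 == 2 ^ nth 0 v 0 * t.*2.+1) * nth 0 v 0)); first by repeat computable_step.
by repeat (computable_step || apply: computable_double).
Qed.

Lemma computable_code_tail : computable1 code_tail.
Proof.
apply: (@computable_sum _ _ (fun i v =>
  \sum_(t < nth 0 v 0) (nth 0 v 0 == 2 ^ i * t.*2.+1) * t)); first by repeat computable_step.
apply: (@computable_sum _ _ (fun t v =>
  (nth 0 (behead v) 0 == 2 ^ nth 0 v 0 * t.*2.+1) * t)); first by repeat computable_step.
by repeat (computable_step || apply: computable_double).
Qed.

Lemma computable_elt n F G : computable n F -> computable n G ->
  computable n (fun v => elt (F v) (G v)).
Proof.
move=> cF cG; apply: computable_ext (computable_app1 computable_code_head
  (computable_iter computable_code_tail cG cF)) => v _.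
by rewrite eltE.
Qed.

Lemma computable_len n F : computable n F -> computable n (fun v => len (F v)).
Proof.
move=> cF; apply: (computable_app1 _ cF).
suff : computable1 (fun c => \sum_(i < c) (iter i code_tail c != 0)).
  by apply: computable_ext => v _; rewrite -lenE.
apply: (@computable_sum _ _ (fun i v => (iter i code_tail (nth 0 v 0) != 0))).
  by repeat computable_step.
apply: decidable_not; apply: decidable_eq; last exact: computable_const.
by apply: (computable_iter computable_code_tail); repeat computable_step.
Qed.

(** [y] codes the positions of an occurrence; its range comes from [code_bound], as all positions
    are below [len s]. *)
Definition code_contains (s b : nat) : bool :=
  [exists y : 'I_(2 ^ ((len s).+1 * len b)), [forall i : 'I_(len b),
    (elt y i < len s) && [forall j : 'I_(len b),
      ((i < j) ==> (elt y i < elt y j)) &&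
      ((elt s (elt y i) < elt s (elt y j)) == (elt b i < elt b j))]]].

Definition code_is_perm (s : nat) : bool :=
  [forall i : 'I_(len s), (0 < elt s i) && (elt s i <= len s) &&
    [forall j : 'I_(len s), (i == j :> nat) || ~~ (elt s i == elt s j)]].

Definition code_simple (s : nat) : bool :=
  [forall i : 'I_(len s).+1, [forall k : 'I_(len s).+1, (i + k <= len s) ==>
    [exists a : 'I_(len s).+1, [forall j : 'I_k,
      (a <= elt s (i + j)) && (elt s (i + j) < a + k)]] ==>
    [|| k == 0 :> nat, k == 1 :> nat | k == len s :> nat]]].

Ltac computable_code := repeat (computable_step || apply: computable_elt || apply: computable_len).

Lemma decidable_code_contains n F G : computable n F -> computable n G ->
  decidable_on n (fun v => code_contains (F v) (G v)).
Proof.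
move=> cF cG.
apply: (@decidable_exists _ _ (fun y v => [forall i : 'I_(len (G v)),
    (elt y i < len (F v)) && [forall j : 'I_(len (G v)),
      ((i < j) ==> (elt y i < elt y j)) &&
      ((elt (F v) (elt y i) < elt (F v) (elt y j)) == (elt (G v) i < elt (G v) j))]])).
  by computable_code.
apply: (@decidable_forall _ _ (fun i v =>
    (elt (nth 0 v 0) i < len (F (behead v))) && [forall j : 'I_(len (G (behead v))),
      ((i < j) ==> (elt (nth 0 v 0) i < elt (nth 0 v 0) j)) &&
      ((elt (F (behead v)) (elt (nth 0 v 0) i) < elt (F (behead v)) (elt (nth 0 v 0) j))
       == (elt (G (behead v)) i < elt (G (behead v)) j))])).
  by computable_code.
apply: decidable_and; first by computable_code.
apply: (@decidable_forall _ _ (fun j v =>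
      ((nth 0 v 0 < j) ==> (elt (nth 0 (behead v) 0) (nth 0 v 0) < elt (nth 0 (behead v) 0) j)) &&
      ((elt (F (behead (behead v))) (elt (nth 0 (behead v) 0) (nth 0 v 0))
        < elt (F (behead (behead v))) (elt (nth 0 (behead v) 0) j))
       == (elt (G (behead (behead v))) (nth 0 v 0) < elt (G (behead (behead v))) j)))).
  by computable_code.
by computable_code.
Qed.

Lemma decidable_code_is_perm n F : computable n F ->
  decidable_on n (fun v => code_is_perm (F v)).
Proof.
move=> cF; apply: (@decidable_forall _ _ (fun i v =>
  (0 < elt (F v) i) && (elt (F v) i <= len (F v)) &&
    [forall j : 'I_(len (F v)), (i == j :> nat) || ~~ (elt (F v) i == elt (F v) j)])).
  by computable_code.
apply: decidable_and; first by computable_code.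
apply: (@decidable_forall _ _ (fun j v => (nth 0 v 0 == j :> nat) ||
  ~~ (elt (F (behead v)) (nth 0 v 0) == elt (F (behead v)) j))).
  by computable_code.
by computable_code.
Qed.

Lemma decidable_code_simple n F : computable n F ->
  decidable_on n (fun v => code_simple (F v)).
Proof.
move=> cF; apply: (@decidable_forall _ _ (fun i v =>
  [forall k : 'I_(len (F v)).+1, (i + k <= len (F v)) ==>
    [exists a : 'I_(len (F v)).+1, [forall j : 'I_k,
      (a <= elt (F v) (i + j)) && (elt (F v) (i + j) < a + k)]] ==>
    [|| k == 0 :> nat, k == 1 :> nat | k == len (F v) :> nat]])).
  by computable_code.
apply: (@decidable_forall _ _ (fun k v =>
  (nth 0 v 0 + k <= len (F (behead v))) ==>
    [exists a : 'I_(len (F (behead v))).+1, [forall j : 'I_k,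
      (a <= elt (F (behead v)) (nth 0 v 0 + j)) && (elt (F (behead v)) (nth 0 v 0 + j) < a + k)]] ==>
    [|| k == 0 :> nat, k == 1 :> nat | k == len (F (behead v)) :> nat])).
  by computable_code.
apply: decidable_imp; first by computable_code.
apply: decidable_imp; last by computable_code.
apply: (@decidable_exists _ _ (fun a v => [forall j : 'I_(nth 0 v 0),
      (a <= elt (F (behead (behead v))) (nth 0 (behead v) 0 + j)) &&
      (elt (F (behead (behead v))) (nth 0 (behead v) 0 + j) < a + nth 0 v 0)])).
  by computable_code.
apply: (@decidable_forall _ _ (fun j v =>
      (nth 0 v 0 <= elt (F (behead (behead (behead v)))) (nth 0 (behead (behead v)) 0 + j)) &&
      (elt (F (behead (behead (behead v)))) (nth 0 (behead (behead v)) 0 + j)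
       < nth 0 v 0 + nth 0 (behead v) 0))).
  by computable_code.
by computable_code.
Qed.

Lemma computable_simple_bound : computable1 simple_bound.
Proof.
have cps : computable1 (pump_states ((bool * bool) * (bool * bool))%type).
  apply: computable_exp; first by computable_code.
  apply: computable_mul; last by computable_code.
  apply: (@computable_sum _ _ (fun i v => (#|{: (bool * bool) * (bool * bool)}| * 2) ^ i));
  by computable_code.
have cpl : computable1 pin_length.
  by apply: computable_add; [exact: cps | computable_code].
have cwr : computable1 wedge_rows.
  apply: computable_mul; first by computable_code.
  by apply: computable_exp; [computable_code | exact: cpl].
have ccc : computable1 cut_count.
  apply/computable_succ/computable_mul; first by computable_code.
  by apply: computable_succ; apply: computable_mul; exact: cwr.
have cml : computable1 monotone_length.
  by apply: computable_succ; apply: computable_exp; [exact: ccc | exact: cpl].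
by apply: computable_succ; apply: computable_mul; exact: cml.
Qed.

(** * The decision procedure *)

Lemma len_code s : len (CodeSeq.code s) = size s.
Proof. by rewrite /len CodeSeq.codeK. Qed.

Lemma elt_code s i : elt (CodeSeq.code s) i = nth 0 s i.
Proof. by rewrite /elt CodeSeq.codeK. Qed.

Lemma code_is_permP s : reflect (is_perm s) (code_is_perm (CodeSeq.code s)).
Proof.
rewrite /code_is_perm len_code; apply: (iffP forallP) => [H|ps i].
  have us : uniq s.
    apply/(uniqP 0) => i j; rewrite !inE => il jl e; apply/eqP.
    have /andP[_ /forallP/(_ (Ordinal jl))] := H (Ordinal il).
    by rewrite /= !elt_code e eqxx orbF.
  have sub : {subset s <= iota 1 (size s)}.
    move=> x /(nthP 0)[i il <-]; have /andP[+ _] := H (Ordinal il).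
    by rewrite elt_code mem_iota add1n ltnS.
  rewrite /is_perm; apply: uniq_perm; rewrite ?iota_uniq //.
  by have [|_] := uniq_min_size us sub; first rewrite size_iota.
have := mem_nth 0 (ltn_ord i).
rewrite (perm_mem ps) mem_iota !elt_code add1n ltnS => -> /=.
by apply/forallP => j; rewrite elt_code nth_uniq ?(is_perm_uniq ps) // orbN.
Qed.

(** Distinct values, [k] in number, within [k] consecutive numbers fill them. This replaces
    [perm_eq] by inequalities that can be tested on codes. *)
Lemma interval_valuesP s i k : is_perm s -> i + k <= size s -> 0 < k ->
  is_interval s i k <->
  exists2 a, a <= size s & forall j, j < k -> a <= nth 0 s (i + j) < a + k.
Proof.
move=> ps ik k0; have us := is_perm_uniq ps.
have szk : size (take k (drop i s)) = k by rewrite size_takel // size_drop; lia.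
have nt j : j < k -> nth 0 (take k (drop i s)) j = nth 0 s (i + j).
  by move=> jk; rewrite nth_take // nth_drop.
have inseg j : j < k -> nth 0 s (i + j) \in take k (drop i s).
  by move=> jk; rewrite -nt // mem_nth // szk.
split=> [[a pa]|[a _ H]].
  have vals j : j < k -> a <= nth 0 s (i + j) < a + k.
    by move=> jk; have := inseg j jk; rewrite (perm_mem pa) mem_iota.
  exists a => //; have /andP[a0 _] := vals 0 k0; apply: leq_trans a0 _.
  have i0 : i + 0 < size s by lia.
  by have := mem_nth 0 i0; rewrite (perm_mem ps) mem_iota add1n ltnS => /andP[].
exists a; have ut : uniq (take k (drop i s)) by rewrite take_uniq // drop_uniq.
apply: uniq_perm; rewrite ?iota_uniq //.
have sub : {subset take k (drop i s) <= iota a k}.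
  by move=> x /(nthP 0)[j]; rewrite szk => jk <-; rewrite nt // mem_iota H.
by have [|_] := uniq_min_size ut sub; first rewrite size_iota szk.
Qed.

Lemma code_simpleP s : reflect (simple_perm s)
  (code_is_perm (CodeSeq.code s) && code_simple (CodeSeq.code s)).
Proof.
apply: (iffP andP) => [[/code_is_permP ps simp]|[ps simp]]; split=> //; last 2 first.
- exact/code_is_permP.
- rewrite /code_simple !len_code; apply/forallP => i; apply/forallP => k.
  apply/implyP => ik; apply/implyP => /existsP[a /forallP H].
  have [//|k0] := posnP k.
  have /(simp _ _ ik) : is_interval s i k.
    apply/(interval_valuesP ps ik k0); exists a; first by rewrite -ltnS.
    by move=> j jk; have := H (Ordinal jk); rewrite elt_code.
  by case=> [e|[e|e]]; [rewrite e in k0 | rewrite e | rewrite e eqxx orbT].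
move=> i k ik [a pa]; have [k0|k0] := posnP k; first by left.
have iv : is_interval s i k by exists a.
have [a' a's H] := (interval_valuesP ps ik k0).1 iv.
rewrite /code_simple !len_code in simp.
have il : i < (size s).+1 by lia.
have kl : k < (size s).+1 by lia.
have al : a' < (size s).+1 by [].
have := forallP (forallP simp (Ordinal il)) (Ordinal kl); rewrite /= ik /=.
case: existsP => [_ /or3P[]/eqP|[]]; auto.
exists (Ordinal al); apply/forallP => j /=; rewrite elt_code; exact: H.
Qed.

Lemma code_containsP s b :
  reflect (contains s b) (code_contains (CodeSeq.code s) (CodeSeq.code b)).
Proof.
rewrite /code_contains !len_code; apply: (iffP existsP) => [[y /forallP H]|].
  apply/containsP; exists (mkseq (elt y) (size b)).
  have lt i : i < size b -> elt y i < size s.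
    by move=> ib; have /andP[] := H (Ordinal ib).
  have H2 i j : i < size b -> j < size b ->
     ((i < j) ==> (elt y i < elt y j)) && ((nth 0 s (elt y i) < nth 0 s (elt y j)) == (nth 0 b i < nth 0 b j)).
    by move=> ib jb; have /andP[_ /forallP/(_ (Ordinal jb))] := H (Ordinal ib); rewrite /= !elt_code.
  split.
  - rewrite sorted_pairwise; last exact: ltn_trans.
    apply/(pairwiseP 0) => i j; rewrite !inE size_mkseq => ib jb ij.
    by rewrite !nth_mkseq //; have /andP[/implyP/(_ ij)] := H2 i j ib jb.
  - by move=> i /mapP[j]; rewrite mem_iota add0n => /= jb ->; exact: lt.
  - split; first by rewrite size_map size_mkseq.
    move=> i j; rewrite size_map size_mkseq => ib jb.
    have e k : k < size b -> nth 0 [seq nth 0 s i | i <- mkseq (elt y) (size b)] k = nth 0 s (elt y k).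
      by move=> kb; rewrite (nth_map 0) ?size_mkseq // nth_mkseq.
    rewrite !e //.
    by have /andP[_ /eqP] := H2 i j ib jb.
case/containsP => idx [si ni [szi iso]]; rewrite size_map in szi iso.
have yb : CodeSeq.code idx < 2 ^ ((size s).+1 * size b).
  by rewrite -szi; apply: code_bound; apply/allP => i /ni/ltnW.
exists (Ordinal yb); apply/forallP => i; rewrite /= !elt_code.
have ii : i < size idx by rewrite szi.
rewrite ni ?mem_nth //=; apply/forallP => j; rewrite !elt_code.
have jj : j < size idx by rewrite szi.
apply/andP; split.
  by apply/implyP => ij; exact: (sorted_ltn_nth ltn_trans 0 si).
by rewrite -iso // !(nth_map 0).
Qed.

Definition search_size (c : nat) : nat := simple_bound (c + 3) + 10.

(** [c] is the code of B and exceeds the length of each element of B; adding 3 ensures [2 < m]. The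
    range of [x] contains the codes of all permutations of length at most [search_size c]. *)
Definition infinite_simples_code (c : nat) : bool :=
  [exists x : 'I_(2 ^ ((search_size c).+1 * search_size c)),
    [&& code_is_perm x, code_simple x, simple_bound (c + 3) <= len x &
      [forall i : 'I_(len c), ~~ code_contains x (elt c i)]]].

Lemma decidable_infinite_simples_code :
  decidable_on 1 (fun v => infinite_simples_code (nth 0 v 0)).
Proof.
have cN n F : computable n F -> computable n (fun v => simple_bound (F v + 3)).
  move=> cF; apply: (computable_app1 computable_simple_bound).
  by apply: computable_add; [|exact: computable_const].
have cS n F : computable n F -> computable n (fun v => search_size (F v)).
  by move=> cF; apply: computable_add; [exact: cN | exact: computable_const].
apply: (@decidable_exists _ _ (fun x v =>
   [&& code_is_perm x, code_simple x, simple_bound (nth 0 v 0 + 3) <= len x &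
      [forall i : 'I_(len (nth 0 v 0)), ~~ code_contains x (elt (nth 0 v 0) i)]])).
  apply: computable_exp; first exact: computable_const.
  by apply: computable_mul; [apply: computable_succ |]; apply: cS; exact: computable_nth0.
apply: decidable_and; first by apply: decidable_code_is_perm; computable_code.
apply: decidable_and; first by apply: decidable_code_simple; computable_code.
apply: decidable_and.
  by apply: decidable_le; [apply: cN; computable_code | computable_code].
apply: (@decidable_forall _ _ (fun i v =>
  ~~ code_contains (nth 0 v 0) (elt (nth 0 (behead v) 0) i))); first by computable_code.
by apply: decidable_not; apply: decidable_code_contains; computable_code.
Qed.

Lemma infinite_simples_codeP B :
  reflect (inf_many_simples B) (infinite_simples_code (code_perms B)).
Proof.
set c := code_perms B.
have lenB : len c = size B by rewrite /c len_code size_map.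
have eltB i : i < size B -> elt c i = CodeSeq.code (nth [::] B i).
  by move=> iB; rewrite /c elt_code (nth_map [::]).
have Bm beta : beta \in B -> size beta <= c + 3.
  move=> bB; apply: leq_trans (leq_size_code beta) (leq_trans _ (leq_addr 3 c)).
  by apply/ltnW/(allP (CodeSeq.ltn_code (map CodeSeq.code B))); exact: map_f.
have avP s : is_perm s -> inAv B s <->
    [forall i : 'I_(len c), ~~ code_contains (CodeSeq.code s) (elt c i)].
  move=> ps; split=> [[_ av]|/forallP H].
    apply/forallP => -[i]; rewrite lenB => /= iB; rewrite eltB //.
    by apply/code_containsP; apply: av; apply: mem_nth.
  split=> // beta /(nthP [::])[i iB <-].
  have il : i < len c by rewrite lenB.
  by have := H (Ordinal il); rewrite /= eltB // => /code_containsP.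
have m2 : 2 < c + 3 by lia.
apply: (iffP existsP) => [[x /and4P[px sx lx ax]] [L HL]|inf].
  rewrite -[val x]CodeSeq.decodeK in px sx ax.
  set s := CodeSeq.decode x in px sx ax.
  have ss : simple_perm s by apply/code_simpleP; rewrite px.
  have av : inAv B s by apply/avP => //; exact: ss.1.
  (* One long simple permutation in the class yields another that is longer than every member of
     [L]. *)
  have [pi [spi avpi /andP[szpi _]]] :=
    large_simple_perms (\max_(t <- L) size t).+1 av ss Bm m2 lx.
  have piL := HL pi spi avpi.
  by have := @leq_bigmax_seq _ L xpredT size pi piL isT; rewrite leqNgt szpi.
have [s [ss av szs]] : exists s, [/\ simple_perm s, inAv B s & simple_bound (c + 3) <= size s].
  (* Otherwise all simple permutations of the class are shorter than [N], their codes are bounded,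
     and they form a finite list. *)
  apply: NNPP => nex; apply: inf; set N := simple_bound (c + 3) in nex.
  exists (map CodeSeq.decode (iota 0 (2 ^ (N.+1 * N)))) => s ss av.
  rewrite -[s]CodeSeq.codeK; apply: map_f; rewrite mem_iota add0n /=.
  have sN : size s < N by rewrite ltnNge; apply/negP => Ns; apply: nex; exists s.
  have sD : all (fun i => i <= N) s.
    apply/allP => i; rewrite (perm_mem ss.1) mem_iota; lia.
  apply: leq_trans (code_bound sD) _.
  by rewrite leq_exp2l // leq_mul2l ltnW ?orbT.
(* The permutation [s] may be too long for the search; one whose length exceeds the bound by at most
   10 takes its place. *)
have [pi [spi avpi szpi]] := large_simple_perms (simple_bound (c + 3)) av ss Bm m2 szs.
have xb : CodeSeq.code pi < 2 ^ ((search_size c).+1 * search_size c).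
  have sD : all (fun i => i <= search_size c) pi.
    apply/allP => i; rewrite (perm_mem spi.1) mem_iota /search_size; lia.
  apply: leq_trans (code_bound sD) _.
  by rewrite leq_exp2l // leq_mul2l /search_size (andP szpi).2 orbT.
exists (Ordinal xb) => /=; have /code_simpleP/andP[-> ->] := spi.
by rewrite len_code (andP szpi).1; apply/avP => //; exact: spi.1.
Qed.

Theorem mainTheorem10 :
  exists p : recf,
    forall B : seq (seq nat), (forall beta, beta \in B -> is_perm beta) ->
      (inf_many_simples B -> reval p [:: code_perms B] 1) /\
      (~ inf_many_simples B -> reval p [:: code_perms B] 0).
Proof.
have [p Hp] := decidable_infinite_simples_code.
exists p => B _; have := Hp [:: code_perms B] erefl; rewrite [nth _ _ _]/=.
by case: infinite_simples_codeP => // ?; split.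
Qed.
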